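(* Let $\alpha>\frac12$ and let $W\in\mathcal W(\alpha)$. For each $n\ge 1$, let $\xi_1,\dots,\xi_n$ be i.i.d. Uniform$([0,1])$, let $M$ be the $n\times n$ probability matrix $M_{ij}=W(\xi_i,\xi_j)\mathbf 1(i\ne j)$, let $A$ be the random adjacency matrix generated from $M$, and let $\widehat M$ be the USVT estimate computed from $A$ with threshold $\tau=c_\tau\sqrt n$, where $c_\tau\ge 4$ is a fixed constant. Then there is a constant $K$ not depending on $n$ such that for all $n$ $$\frac1{n^2}\,E\left[\|\widehat M-M\|_F^2\right]\le K\,n^{-\frac{2\alpha-1}{2\alpha}},$$ where the expectation is taken over both $\xi=(\xi_1,\dots,\xi_n)$ and $A$.
   Context: A graphon is a symmetric measurable function $W:[0,1]\times[0,1]\to[0,1]$. It defines the compact symmetric operator $(T_WX)(v)=\int_0^1W(u,v)X(u)\,du$ on $L_2([0,1])$, with eigenvalues $\omega_1,\omega_2,\dots$ (ordered so that $|\omega_1|\ge|\omega_2|\ge\cdots$) and a corresponding orthonormal basis of eigenfunctions $\varphi_1,\varphi_2,\dots$ of $L_2([0,1])$, so that $W(x,y)=\sum_i\omega_i\varphi_i(x)\varphi_i(y)$ in $L_2$. Standing assumptions: all graphons are trace-class, i.e. $\sum_i|\omega_i|<\infty$, and (after modification on a null set) the identity $W(x,y)=\sum_i\omega_i\varphi_i(x)\varphi_i(y)$ is taken to hold everywhere. $W$ has polynomial spectral decay with rate $\alpha$ if $|\omega_k|\le Ck^{-\alpha}$ for all $k$, where $C>0$ is a fixed constant. $\mathcal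 W(\alpha)$ is the set of graphons with polynomial spectral decay with rate $\alpha$ for which the partial sums of the diagonal $\sum_{i=1}^k\omega_i\varphi_i^2(x)$ converge to $W(x,x)$ in $L_2([0,1])$ as $k\to\infty$. Adjacency matrix: given $M$, $A$ is symmetric with zero diagonal and, for $1\le i<j\le n$, the entries $A_{ij}\sim\text{Bernoulli}(M_{ij})$ are independent. USVT estimate with threshold $\tau>0$: let $A=\sum_{i=1}^n s_iu_iv_i^T$ be a singular value decomposition with $s_1\ge\cdots\ge s_n$, let $S=\{i:s_i\ge\tau\}$, form $\sum_{i\in S}s_iu_iv_i^T$, replace entries below $0$ by $0$ and entries above $1$ by $1$, and set the diagonal to zero; the result is $\widehat M$. $\|\cdot\|_F$ is the Frobenius norm. *)

(* Defs.v *)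
From HB Require Import structures.
From mathcomp Require Import all_boot all_order all_algebra.
From mathcomp Require Import all_classical all_reals all_analysis.

Set Implicit Arguments.
Unset Strict Implicit.
Unset Printing Implicit Defensive.
Import Order.TTheory GRing.Theory Num.Theory.
Import numFieldNormedType.Exports.

Local Open Scope classical_set_scope.
Local Open Scope ring_scope.

Section Graphons.
Context {R : realType}.
Implicit Types (W : R -> R -> R) (f g : R -> R).

Local Notation mu := (@lebesgue_measure R).
Local Notation I01 := (`[0, 1]%classic : set R).

(* Functions on [0,1] (resp. [0,1]^2) are total functions on R (resp. R^2)
   whose values outside of the interval (resp. square) are irrelevant. *)
Definition graphon W :=
  [/\ measurable_fun (I01 `*` I01) (fun p : R * R => W p.1 p.2),
      forall x y, I01 x -> I01 y -> W x y = W y x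
    & forall x y, I01 x -> I01 y -> 0 <= W x y <= 1].

Definition in_L2 f :=
  measurable_fun I01 f /\ (\int[mu]_(x in I01) (f x ^+ 2)%:E < +oo)%E.

Definition inner_L2 f g : R := \int[mu]_(x in I01) (f x * g x).

Definition graphon_op W f : R -> R :=
  fun v => \int[mu]_(u in I01) (W u v * f u).

(* The eigenvalues and eigenfunctions are indexed from 0.  An enumeration with
   nonincreasing |omega i| cannot list the kernel of the operator when there
   are infinitely many nonzero eigenvalues, so phi is an orthonormal sequence
   of eigenfunctions which becomes an orthonormal basis of L2 once completed by
   an orthonormal basis of a subspace of the kernel: every function orthogonal
   to all the phi i is in the kernel. *)
Definition ordered_eigensystem W (omega : nat -> R) (phi : nat -> R -> R) :=
  [/\ forall i, in_L2 (phi i),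
      forall i j, inner_L2 (phi i) (phi j) = (i == j)%:R,
      forall i, {ae mu, forall v, I01 v ->
        graphon_op W (phi i) v = omega i * phi i v},
      forall f, in_L2 f -> (forall i, inner_L2 f (phi i) = 0) ->
        {ae mu, forall v, I01 v -> graphon_op W f v = 0}
    & forall i, `|omega i.+1| <= `|omega i|].

Definition trace_class_expansion W (omega : nat -> R) (phi : nat -> R -> R) :=
  cvgn (series (fun i => `|omega i|)) /\
  forall x y, I01 x -> I01 y ->
    (\sum_(i < k) omega i * phi i x * phi i y) @[k --> \oo] --> W x y.

Definition polynomial_decay (alpha : R) (omega : nat -> R) :=
  exists2 C : R, 0 < C &
    forall k, `|omega k| <= C * (k.+1%:R : R) `^ (- alpha).

Definition diagonal_cvg_L2 W (omega : nat -> R) (phi : nat -> R -> R) :=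
  (\int[mu]_(x in I01)
     ((\sum_(i < k) omega i * phi i x ^+ 2 - W x x) ^+ 2)%:E)%E
  @[k --> \oo] --> 0%E.

Definition graphon_class (alpha : R) : set (R -> R -> R) :=
  [set W | graphon W /\
    exists omega phi,
      [/\ ordered_eigensystem W omega phi,
          trace_class_expansion W omega phi,
          polynomial_decay alpha omega
        & diagonal_cvg_L2 W omega phi]].

End Graphons.

Section RandomGraph.
Context {R : realType} {d : measure_display} {T : measurableType d}.
Variables (P : probability T R) (n : nat).

Local Open Scope ereal_scope.

Definition iid_uniform01 (xi : 'I_n -> {RV P >-> R}) :=
  (forall i (B : set R), measurable B ->
     distribution P (xi i) B = uniform_prob (@ltr01 R) B) /\
  (forall B : 'I_n -> set R, (forall i, measurable (B i)) ->
     P [set t | forall i, B i (xi i t)] = \prod_(i < n) P (xi i @^-1` B i)).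

(* Conditionally on sigma(xi), the entries above the diagonal are independent
   and A i j has law Bernoulli(M i j): for all B,
     P(A i j \in B i j for all i < j | xi)
       = \prod_(i < j) Bernoulli(M i j) (B i j),
   the conditional probability being spelled out by its integrals over the
   events E of sigma(xi). *)
Definition adjacency_given (xi : 'I_n -> {RV P >-> R}) (M : T -> 'M[R]_n)
    (A : T -> 'M[bool]_n) :=
  [/\ forall i j, measurable_fun setT (fun t => A t i j),
      forall t, (A t)^T%R = A t,
      forall t i, A t i i = false
    & forall (E : set T) (B : 'I_n -> 'I_n -> set bool),
        g_sigma_preimage (fun i => xi i : T -> R) E ->
        P (E `&` [set t | forall i j : 'I_n, (i < j)%N -> B i j (A t i j)]) =
        \int[P]_(t in E) \prod_(ij : 'I_n * 'I_n | (ij.1 < ij.2)%N)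
          bernoulli_prob (M t ij.1 ij.2) (B ij.1 ij.2)].

End RandomGraph.

Section Matrices.
Context {R : realType} {n : nat}.
Implicit Types (A U V M : 'M[R]_n) (s : 'I_n -> R).

Definition prob_matrix (W : R -> R -> R) (x : 'I_n -> R) : 'M[R]_n :=
  \matrix_(i, j) (W (x i) (x j) * (i != j)%:R).

Definition real_mx (A : 'M[bool]_n) : 'M[R]_n :=
  map_mx (fun b : bool => b%:R) A.

Definition frobenius_norm A : R := Num.sqrt (\sum_i \sum_j A i j ^+ 2).

Definition is_svd A U s V :=
  [/\ U^T *m U = 1%:M /\ V^T *m V = 1%:M,
      forall i, 0 <= s i,
      forall i j : 'I_n, (i <= j)%N -> s j <= s i
    & A = \sum_i s i *: (col i U *m (col i V)^T)].

Definition clip01 (x : R) : R := Num.min 1 (Num.max 0 x).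

(* The thresholded sum does not depend on the chosen decomposition. *)
Definition is_usvt (tau : R) A Mhat :=
  exists U s V, is_svd A U s V /\
    Mhat = \matrix_(i, j)
      (if i == j then 0 else
       clip01 ((\sum_(k | tau <= s k) s k *: (col k U *m (col k V)^T)) i j)).

End Matrices.

(* Main.v *)
Require Import Defs.
From HB Require Import structures.
From mathcomp Require Import all_boot all_order all_algebra.
From mathcomp Require Import all_classical all_reals all_analysis.
From mathcomp Require Import measurable_realfun ring lra zify.

Set Implicit Arguments.
Unset Strict Implicit.
Unset Printing Implicit Defensive.
Import Order.TTheory GRing.Theory Num.Theory.
Import numFieldNormedType.Exports.

Local Open Scope classical_set_scope.
Local Open Scope ring_scope.

(** Let M be the probability matrix, X = A - M the noise, tau = ctau sqrt n the
    threshold, and B_r the matrix with entries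
    sum_(k < r) omega_k phi_k(xi_i) phi_k(xi_j), whose rank is at most r.

    Thresholding is a deterministic matter once the noise is small.  If
    |y^T X y| <= k |y|^2 for all y, with k <= (15/16) tau, then for every r the
    thresholded matrix is within 72 tau^2 r + 4097 |M - B_r|_F^2 of M in
    squared Frobenius norm ([truncation_error]).  Indeed a singular value of A
    above tau cannot be made of noise only, so that there are at most
    O(r + |M - B_r|_F^2 / tau^2) of them ([large_singular_values_count]); on the
    span of their singular vectors and of the columns of B_r the error has
    operator norm at most tau + k, and off that span it is that of B_r.
    Clipping to [0,1] and clearing the diagonal can only help ([usvt_error]).

    The noise is small with high probability, given xi.  The diagonal of X
    vanishes, hence y^T X y is affine in each coordinate of y, and rounding the
    coordinates one at a time, each in the favourable direction, replaces y by
    a lattice point without decreasing the form ([mxform_rounding]).  After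
    scaling y to norm 8 sqrt n the lattice points have norm at most 9 sqrt n,
    and there are at most 54^n of them ([card_lattice_ball]).  A Chernoff bound
    for each of them and a union bound show that k = (15/4) sqrt n fails with
    probability at most 2 (9/10)^n ([large_noise_weight],
    [large_noise_probability]).  This is where ctau >= 4 enters:
    15/4 = (15/16) 4.  When k fails, the squared error is at most n^2.

    It remains to average |M - B_r|_F^2 over xi ([expected_truncation_error]).
    Off the diagonal, an entry contributes the squared L2 distance from W to its
    partial sum, which is at most sum_(k >= r) omega_k^2 by orthonormality and
    Fatou's lemma ([truncation_L2_error]), that is O(r^(1 - 2 alpha)).  On the
    diagonal M is zero, and the n entries of B_r have bounded second moments as
    soon as r is large, because the partial sums of the diagonal converge in L2
    ([diagonal_L2_bounded]).  Dividing by n^2, the risk is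
    O(r / n + r^(1 - 2 alpha) + 1 / n), and r of order n^(1 / (2 alpha))
    balances the first two terms ([truncation_rank]). *)

(** * Squared Frobenius norm and orthogonal projectors *)

Section SquaredFrobenius.
Context {R : realFieldType}.

(** The square of [frobenius_norm], which makes sense over any real field and
    is additive over orthogonal decompositions. *)
Definition sqfro m n (A : 'M[R]_(m, n)) : R := \sum_i \sum_j A i j ^+ 2.

Lemma sqfro_ge0 m n (A : 'M[R]_(m, n)) : 0 <= sqfro A.
Proof. by apply: sumr_ge0 => i _; apply: sumr_ge0 => j _; exact: sqr_ge0. Qed.

Lemma sqfro_tr m n (A : 'M[R]_(m, n)) : sqfro A^T = sqfro A.
Proof.
rewrite /sqfro exchange_big /=; apply: eq_bigr => i _.
by apply: eq_bigr => j _; rewrite mxE.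
Qed.

Lemma sqfro_trace m n (A : 'M[R]_(m, n)) : sqfro A = \tr (A^T *m A).
Proof.
rewrite -sqfro_tr; apply: eq_bigr => i _; rewrite mxE.
by apply: eq_bigr => j _; rewrite !mxE expr2.
Qed.

Lemma sqfro_eq0 m n (A : 'M[R]_(m, n)) : sqfro A = 0 -> A = 0.
Proof.
move=> A0; apply/matrixP => i j; rewrite mxE; apply/eqP; rewrite -sqrf_eq0.
apply/eqP/(psumr_eq0P (P := predT) (F := fun j => A i j ^+ 2)) => // [k _|].
  exact: sqr_ge0.
apply: (psumr_eq0P (P := predT) (F := fun i => \sum_j A i j ^+ 2)) => // k _.
by apply: sumr_ge0 => l _; exact: sqr_ge0.
Qed.

Lemma sqfroZ m n (a : R) (A : 'M[R]_(m, n)) : sqfro (a *: A) = a ^+ 2 * sqfro A.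
Proof.
rewrite /sqfro mulr_sumr; apply: eq_bigr => i _; rewrite mulr_sumr.
by apply: eq_bigr => j _; rewrite mxE exprMn.
Qed.

Lemma sqfroN m n (A : 'M[R]_(m, n)) : sqfro (- A) = sqfro A.
Proof. by rewrite -scaleN1r sqfroZ sqrrN expr1n mul1r. Qed.

Lemma sqfroD_le m n (A B : 'M[R]_(m, n)) :
  sqfro (A + B) <= 2 * sqfro A + 2 * sqfro B.
Proof.
rewrite /sqfro !mulr_sumr -big_split /=; apply: ler_sum => i _.
rewrite !mulr_sumr -big_split /=; apply: ler_sum => j _.
by rewrite mxE; have := sqr_ge0 (A i j - B i j); lra.
Qed.

Lemma sqfro_cols m n (A : 'M[R]_(m, n)) : sqfro A = \sum_j sqfro (col j A).
Proof.
rewrite /sqfro exchange_big; apply: eq_bigr => j _; apply: eq_bigr => i _.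
by rewrite big_ord1 mxE.
Qed.

Lemma sqfro_cV n (x : 'cV[R]_n) : (x^T *m x) 0 0 = sqfro x.
Proof. by rewrite sqfro_trace /mxtrace big_ord1. Qed.

Lemma col_mulmx m n p (A : 'M[R]_(m, n)) (B : 'M[R]_(n, p)) j :
  col j (A *m B) = A *m col j B.
Proof. by rewrite !colE mulmxA. Qed.

Lemma mulmx3_entry n p q r (A : 'M[R]_(n, p)) (Y : 'M[R]_(p, q))
    (B : 'M[R]_(q, r)) i j :
  (A *m Y *m B) i j = ((col i A^T)^T *m Y *m col j B) 0 0.
Proof.
by rewrite tr_col trmxK -row_mul -col_mulmx !mxE; apply: eq_bigr => k _; rewrite !mxE.
Qed.

Lemma sqfro_mul_le p q r (Y : 'M[R]_(p, q)) (Z : 'M[R]_(q, r)) (c : R) :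
  (forall x : 'cV_q, sqfro (Y *m x) <= c * sqfro x) ->
  sqfro (Y *m Z) <= c * sqfro Z.
Proof.
move=> hY; rewrite (sqfro_cols (Y *m Z)) (sqfro_cols Z) mulr_sumr.
by apply: ler_sum => j _; rewrite col_mulmx.
Qed.

Lemma sqfro_orth m n (U : 'M[R]_m) (A : 'M[R]_(m, n)) :
  U^T *m U = 1%:M -> sqfro (U *m A) = sqfro A.
Proof.
by move=> hU; rewrite !sqfro_trace trmx_mul mulmxA -(mulmxA A^T) hU mulmx1.
Qed.

Lemma sqfro_orthr m n (U : 'M[R]_n) (A : 'M[R]_(m, n)) :
  U^T *m U = 1%:M -> sqfro (A *m U) = sqfro A.
Proof.
move=> hU; rewrite -sqfro_tr trmx_mul sqfro_orth ?sqfro_tr//.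
by rewrite trmxK; exact: mulmx1C.
Qed.

End SquaredFrobenius.

Section Projectors.
Context {R : realFieldType}.

Definition orth_projector n (Q : 'M[R]_n) := Q^T = Q /\ Q *m Q = Q.

Lemma sqfro_projector n m (Q : 'M[R]_n) (Y : 'M[R]_(n, m)) :
  orth_projector Q -> sqfro (Q *m Y) = \tr (Y^T *m Q *m Y).
Proof.
case=> QT QQ; rewrite sqfro_trace trmx_mul QT.
by rewrite mulmxA -(mulmxA Y^T Q Q) QQ.
Qed.

Lemma orth_projectorC n (Q : 'M[R]_n) :
  orth_projector Q -> orth_projector (1%:M - Q).
Proof.
case=> QT QQ; split; first by rewrite linearB /= trmx1 QT.
by rewrite mulmxBl mul1mx mulmxBr mulmx1 QQ subrr subr0.
Qed.

Lemma projector_pythagoras n m (Q : 'M[R]_n) (Y : 'M[R]_(n, m)) :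
  orth_projector Q -> sqfro Y = sqfro (Q *m Y) + sqfro ((1%:M - Q) *m Y).
Proof.
move=> hQ; rewrite !sqfro_projector//; last exact: orth_projectorC.
by rewrite mulmxBr mulmx1 mulmxBl linearB /= addrC subrK sqfro_trace.
Qed.

Lemma sqfro_projector_le n m (Q : 'M[R]_n) (Y : 'M[R]_(n, m)) :
  orth_projector Q -> sqfro (Q *m Y) <= sqfro Y.
Proof.
by move=> hQ; rewrite (projector_pythagoras Y hQ) lerDl sqfro_ge0.
Qed.

Lemma sqfro_projector_trace n (Q : 'M[R]_n) :
  orth_projector Q -> sqfro Q = \tr Q.
Proof. by case=> QT QQ; rewrite sqfro_trace QT QQ. Qed.

(** The orthogonal projector with a prescribed kernel, built without an
    orthonormal basis: if c = Q b is nonzero, subtracting from Q the projector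
    onto c kills b as well, and increases the trace of 1 - Q, which is the
    dimension of the space killed so far, by one. *)
Lemma projector_killing n (s : seq 'cV[R]_n) :
  exists Q : 'M[R]_n, [/\ orth_projector Q,
    forall b, b \in s -> Q *m b = 0 & \tr (1%:M - Q) <= (size s)%:R].
Proof.
elim: s => [|b s [Q [[QT QQ] Qs trQ]]].
  by exists 1%:M; split=> //; [split; rewrite ?trmx1 ?mulmx1 | rewrite subrr mxtrace0].
pose c := Q *m b; have [c0|c0] := eqVneq (sqfro c) 0.
  exists Q; split=> // [x|].
    by rewrite inE => /predU1P[->|/Qs//]; exact: sqfro_eq0.
  by apply: le_trans trQ _; rewrite ler_nat /=.
have cTc : c^T *m c = (sqfro c)%:M by rewrite [LHS]mx11_scalar sqfro_cV.
have Qc : Q *m c = c by rewrite /c mulmxA QQ.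
have cQ : c^T *m Q = c^T by rewrite -{1}QT -trmx_mul Qc.
have cTx x : c^T *m x = b^T *m (Q *m x) by rewrite /c trmx_mul QT mulmxA.
have cTb : c^T *m b = (sqfro c)%:M by rewrite cTx -cTc cTx Qc.
pose a := (sqfro c)^-1.
have ac : a * sqfro c = 1 by rewrite mulVf.
exists (Q - a *: (c *m c^T)); split.
- split; first by rewrite linearB /= linearZ /= trmx_mul trmxK QT.
  have ccK : (c *m c^T) *m (c *m c^T) = sqfro c *: (c *m c^T).
    by rewrite mulmxA -(mulmxA c c^T c) cTc mul_mx_scalar -scalemxAl.
  rewrite mulmxBl !mulmxBr QQ -!scalemxAr -!scalemxAl ccK.
  rewrite mulmxA Qc -(mulmxA c c^T Q) cQ (scalerA a (sqfro c)) ac scale1r.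
  by rewrite subrr subr0.
- move=> x; rewrite inE mulmxBl -scalemxAl -mulmxA => /predU1P[->|xs].
    by rewrite cTb mul_mx_scalar scalerA ac scale1r subrr.
  by rewrite cTx Qs// !mulmx0 scaler0 subrr.
- rewrite opprB addrCA addrC linearD /= linearZ /= mxtrace_mulC.
  by rewrite cTc mxtrace_scalar mulr1n ac /= -natr1 lerD2r.
Qed.

End Projectors.

Section Forms.
Context {R : realFieldType} {n : nat}.
Implicit Types (X : 'M[R]_n) (u v w : 'cV[R]_n).

Definition mxform X u v : R := (u^T *m X *m v) 0 0.

Lemma mxformDl X u v w : mxform X (u + v) w = mxform X u w + mxform X v w.
Proof. by rewrite /mxform linearD /= !mulmxDl mxE. Qed.

Lemma mxformDr X u v w : mxform X w (u + v) = mxform X w u + mxform X w v.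
Proof. by rewrite /mxform mulmxDr mxE. Qed.

Lemma mxformZl X a u w : mxform X (a *: u) w = a * mxform X u w.
Proof. by rewrite /mxform linearZ /= -!scalemxAl mxE. Qed.

Lemma mxformZr X a u w : mxform X w (a *: u) = a * mxform X w u.
Proof. by rewrite /mxform -scalemxAr mxE. Qed.

Lemma mxformNl X u w : mxform X (- u) w = - mxform X u w.
Proof. by rewrite -scaleN1r mxformZl mulN1r. Qed.

Lemma mxformNr X u w : mxform X w (- u) = - mxform X w u.
Proof. by rewrite -scaleN1r mxformZr mulN1r. Qed.

Lemma mxformN X u v : mxform (- X) u v = - mxform X u v.
Proof. by rewrite /mxform mulmxN mulNmx mxE. Qed.

Lemma mxform_sym X : X^T = X -> forall u v, mxform X u v = mxform X v u.
Proof.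
move=> XT u v; rewrite /mxform.
have -> : v^T *m X *m u = (u^T *m X *m v)^T by rewrite !trmx_mul trmxK XT mulmxA.
by rewrite [RHS]mxE.
Qed.

Lemma mxformE X u v : mxform X u v = \sum_i \sum_j u i 0 * X i j * v j 0.
Proof.
rewrite /mxform -mulmxA mxE; apply: eq_bigr => i _.
by rewrite !mxE mulr_sumr; apply: eq_bigr => j _; rewrite mulrA.
Qed.

End Forms.

(** * Singular value thresholding near a low-rank matrix *)

Section Thresholding.
Context {R : realFieldType}.
Variable n : nat.
Implicit Types (X Y : 'M[R]_n).

(** Polarization, followed by the parallelogram identity. *)
Lemma quadratic_to_bilinear X (k : R) :
  X^T = X -> (forall y, `|mxform X y y| <= k * sqfro y) ->
  forall x y, `|mxform X x y| <= k * ((sqfro x + sqfro y) / 2).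
Proof.
move=> XT hX x y.
have par : sqfro (x + y) + sqfro (x - y) = 2 * (sqfro x + sqfro y).
  rewrite /sqfro mulrDr !mulr_sumr -!big_split /=; apply: eq_bigr => i _.
  by rewrite !big_ord1 !mxE; ring.
have dif : mxform X (x + y) (x + y) - mxform X (x - y) (x - y) =
    4 * mxform X x y.
  rewrite !(mxformDl, mxformDr, mxformNl, mxformNr) (mxform_sym XT y x); ring.
have := hX (x + y); have := hX (x - y).
rewrite !ler_norml => /andP[h1 h2] /andP[h3 h4].
have -> : k * ((sqfro x + sqfro y) / 2) =
    (k * sqfro (x + y) + k * sqfro (x - y)) / 4.
  by rewrite -mulrDr par; field.
by apply/andP; split; lra.
Qed.

(** The bilinear bound at x = k^-1 X y, the multiple of X y for which the two
    terms of the bound balance. *)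
Lemma quadratic_to_operator X (k : R) :
  X^T = X -> 0 < k -> (forall y, `|mxform X y y| <= k * sqfro y) ->
  forall y : 'cV_n, sqfro (X *m y) <= k ^+ 2 * sqfro y.
Proof.
move=> XT k0 hX y.
have := quadratic_to_bilinear XT hX (k^-1 *: (X *m y)) y.
rewrite sqfroZ mxformZl {1}/mxform -mulmxA sqfro_cV => /(le_trans (ler_norm _)).
set a := sqfro (X *m y); set b := sqfro y => h.
have : 2 * k * (k^-1 * a) <= 2 * k * (k * ((k^-1 ^+ 2 * a + b) / 2)).
  by rewrite ler_pM2l// mulr_gt0.
have -> : 2 * k * (k^-1 * a) = 2 * a by field; rewrite gt_eqF.
have -> : 2 * k * (k * ((k^-1 ^+ 2 * a + b) / 2)) = a + k ^+ 2 * b.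
  by field; rewrite gt_eqF.
by lra.
Qed.

Variables (A U V M : 'M[R]_n) (s : 'I_n -> R) (tau : R).
Hypotheses (U1 : U^T *m U = 1%:M) (V1 : V^T *m V = 1%:M).
Hypothesis s_ge0 : forall i, 0 <= s i.
Hypothesis A_svd : A = \sum_i s i *: (col i U *m (col i V)^T).
Hypothesis tau_gt0 : 0 < tau.

Let Ahat := \sum_(i | tau <= s i) s i *: (col i U *m (col i V)^T).

Let svd_diag (P : pred 'I_n) :
  \sum_(i | P i) s i *: (col i U *m (col i V)^T) =
  U *m diag_mx (\row_i (if P i then s i else 0)) *m V^T.
Proof.
apply/matrixP => i j; rewrite summxE mxE big_mkcond /=.
apply: eq_bigr => k _; rewrite mul_mx_diag !mxE.
case: (P k); rewrite ?mulr0 ?mul0r// big_ord1 !mxE.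
by rewrite [s k * _]mulrCA mulrA.
Qed.

(** What thresholding removes is U D V^T, where D keeps the singular values below
    [tau]. *)
Lemma truncation_residual (x : 'cV[R]_n) :
  sqfro ((Ahat - A)^T *m x) <= tau ^+ 2 * sqfro x.
Proof.
pose D : 'M[R]_n := diag_mx (\row_i (if ~~ (tau <= s i) then s i else 0)).
have -> : (Ahat - A)^T = - (V *m D *m U^T).
  rewrite A_svd (bigID (fun i => tau <= s i)) /= -/Ahat opprD addrA subrr sub0r.
  by rewrite svd_diag linearN /= !trmx_mul trmxK tr_diag_mx mulmxA.
rewrite mulNmx sqfroN -!mulmxA sqfro_orth//.
have -> : sqfro x = sqfro (U^T *m x).
  by rewrite sqfro_orth// trmxK; exact: mulmx1C.
rewrite /sqfro mulr_sumr; apply: ler_sum => i _; rewrite !big_ord1.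
rewrite mul_diag_mx !mxE exprMn; apply: ler_wpM2r; first exact: sqr_ge0.
case: ifPn => [|_]; last by rewrite expr0n /= sqr_ge0.
rewrite -ltNge => /ltW lts.
by apply: ler_pM => //; apply: s_ge0.
Qed.

Let mul_svd_col k : A *m col k V = s k *: col k U.
Proof.
rewrite A_svd svd_diag -mulmxA.
have -> : V^T *m col k V = col k 1%:M by rewrite -col_mulmx V1.
apply/matrixP => i j; rewrite -col_mulmx mulmx1 mxE mul_mx_diag !mxE.
by rewrite mulrC.
Qed.

Variables (r : nat) (F : 'M[R]_(n, r)) (G : 'M[R]_(r, n)) (k : R).
Hypothesis symX : (A - M)^T = A - M.
Hypothesis k_gt0 : 0 < k.
Hypothesis k_tau : k <= 15 / 16 * tau.
Hypothesis normX :
  forall y, `|mxform (A - M) y y| <= k * sqfro y.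

Let eps := sqfro (M - F *m G).

(** Besides the columns of [F], which contain the range of the approximation
    [F *m G], the projector can be asked to kill singular vectors. *)
Lemma projector_killing_cols (s' : seq 'cV[R]_n) : exists Q : 'M[R]_n,
  [/\ orth_projector Q, Q *m F = 0, forall b, b \in s' -> Q *m b = 0 &
      \tr (1%:M - Q) <= r%:R + (size s')%:R].
Proof.
have [Q [Qp Qs trQ]] := projector_killing ([seq col i F | i : 'I_r] ++ s').
exists Q; split=> //.
- apply/matrixP => i j; rewrite mxE.
  have /Qs : col j F \in [seq col i F | i : 'I_r] ++ s'.
    by rewrite mem_cat; apply/orP; left; apply/fintype.imageP; exists j.
  by rewrite -col_mulmx => /matrixP/(_ i 0); rewrite !mxE.
- by move=> b bs; apply: Qs; rewrite mem_cat bs orbT.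
- by move: trQ; rewrite size_cat size_map size_enum_ord natrD.
Qed.

(** Let Q kill the range of F G, and w_i = |Q u_i|^2, where u_i and v_i are
    singular vectors for s_i >= tau.  Pairing Q u_i with A v_i gives
    tau w_i <= k (w_i + 1) / 2 + e_i, with e_i = u_i^T Q (M - F G) v_i.  As k is
    smaller than tau by a fixed factor, either w_i is bounded away from 1, which
    the trace of 1 - Q allows for O(r) indices only, or e_i is at least a
    fixed fraction of tau, which the Frobenius norm of M - F G allows for
    O(eps / tau^2) indices only. *)
Lemma large_singular_values_count :
  #|[pred i | tau <= s i]|%:R <= 17 * r%:R + 1024 / tau ^+ 2 * eps.
Proof.
have [Q [Qp QF _ trQ]] := projector_killing_cols [::].
rewrite addr0 in trQ.
pose w i := sqfro (Q *m col i U).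
pose e i := ((col i U)^T *m (Q *m (M - F *m G)) *m col i V) 0 0.
have sqU i : sqfro (col i U) = 1.
  have : (U^T *m U) i i = 1 by rewrite U1 mxE eqxx.
  rewrite -[U^T]mulmx1 mulmx3_entry trmxK mulmx1 sqfro_cV; exact.
have sqV i : sqfro (col i V) = 1.
  have : (V^T *m V) i i = 1 by rewrite V1 mxE eqxx.
  rewrite -[V^T]mulmx1 mulmx3_entry trmxK mulmx1 sqfro_cV; exact.
have w_le1 i : w i <= 1 by rewrite -(sqU i); exact: sqfro_projector_le.
have sum_w : \sum_i (1 - w i) <= r%:R.
  have -> : \sum_i (1 - w i) = \tr (1%:M - Q).
    have cQ := orth_projectorC Qp.
    rewrite -(sqfro_projector_trace cQ) -(@sqfro_orthr _ _ _ U)//.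
    rewrite sqfro_cols; apply: eq_bigr => i _.
    by rewrite col_mulmx; have := projector_pythagoras (col i U) Qp; rewrite sqU /w; lra.
  exact: trQ.
have sum_e : \sum_i e i ^+ 2 <= eps.
  apply: (@le_trans _ _ (sqfro (U^T *m (Q *m (M - F *m G)) *m V))).
    apply: ler_sum => i _; rewrite (bigD1 i)//= mulmx3_entry trmxK lerDl.
    by apply: sumr_ge0 => j _; exact: sqr_ge0.
  rewrite sqfro_orthr// sqfro_orth; last by rewrite trmxK; exact: mulmx1C.
  exact: sqfro_projector_le.
have c0 : 0 <= 1024 / tau ^+ 2 by apply: divr_ge0; [exact: ler0n|exact: sqr_ge0].
have key i : tau <= s i -> 1 <= 17 * (1 - w i) + 1024 / tau ^+ 2 * e i ^+ 2.
  move=> si.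
  have wE : w i = ((col i U)^T *m Q *m col i U) 0 0.
    by rewrite /w sqfro_projector// /mxtrace big_ord1.
  have main : tau * w i <= k * ((w i + 1) / 2) + e i.
    have : s i * w i = ((col i U)^T *m Q *m (A - M) *m col i V) 0 0 + e i.
      have QM : Q *m (M - F *m G) = Q *m M.
        by rewrite mulmxBr mulmxA QF mul0mx subr0.
      rewrite /e QM mulmxBr mulmxBl.
      rewrite -(mulmxA _ A) mul_svd_col -scalemxAr (mulmxA (col i U)^T Q M).
      by rewrite wE !mxE; ring.
    have /(le_trans (ler_norm _)) :=
      quadratic_to_bilinear symX normX (Q *m col i U) (col i V).
    rewrite {1}/mxform trmx_mul Qp.1 sqV => h1 h2; rewrite -/(w i) in h1.
    apply: (@le_trans _ _ (s i * w i)); last by rewrite h2 lerD2r.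
    by rewrite ler_wpM2r// sqfro_ge0.
  have w0 : 0 <= w i by exact: sqfro_ge0.
  have main2 : tau * w i <= 15 / 16 * tau * ((w i + 1) / 2) + e i.
    apply: (le_trans main); rewrite lerD2r ler_wpM2r//; lra.
  (* 16/17 > 15/17, the value of w i above which the inequality forces e i > 0 *)
  have [wbig|wsmall] := leP (16 / 17) (w i); last first.
    have : 0 <= 1024 / tau ^+ 2 * e i ^+ 2.
      by apply: mulr_ge0; [exact: c0|exact: sqr_ge0].
    by lra.
  have eb : tau / 32 <= e i.
    have : tau * (16 / 17) <= tau * w i by rewrite ler_pM2l.
    by nra.
  have e2 : (tau / 32) ^+ 2 <= e i ^+ 2.
    have t32 : 0 <= tau / 32 by rewrite divr_ge0// ltW.
    by rewrite lerXn2r// nnegrE//; exact: le_trans eb.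
  have : 1024 / tau ^+ 2 * (tau / 32) ^+ 2 <= 1024 / tau ^+ 2 * e i ^+ 2.
    by apply: ler_wpM2l; [exact: c0|exact: e2].
  have -> : 1024 / tau ^+ 2 * (tau / 32) ^+ 2 = 1.
    by field; rewrite gt_eqF.
  by have := w_le1 i; lra.
rewrite -sum1_card natr_sum.
apply: (@le_trans _ _ (\sum_(i | tau <= s i)
    (17 * (1 - w i) + 1024 / tau ^+ 2 * e i ^+ 2))).
  by apply: ler_sum => i; exact: key.
apply: (@le_trans _ _ (\sum_i (17 * (1 - w i) + 1024 / tau ^+ 2 * e i ^+ 2))).
  rewrite [leRHS](bigID (fun i => tau <= s i)) /= lerDl.
  apply: sumr_ge0 => i _; apply: addr_ge0.
    by have := w_le1 i; lra.
  by apply: mulr_ge0; [exact: c0|exact: sqr_ge0].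
rewrite big_split /= -!mulr_sumr; apply: lerD; apply: ler_wpM2l => //.
Qed.

(** Let P = 1 - Q project onto the span of the columns of F and of the u_i with
    s_i >= tau.  Off that span the thresholded matrix vanishes, and so does
    F G; on it the error is bounded by the operator norm times the dimension. *)
Lemma truncation_error :
  sqfro (Ahat - M) <= 72 * tau ^+ 2 * r%:R + 4097 * eps.
Proof.
pose S := [pred i | tau <= s i].
have [Q [Qp QF QU trQ]] := projector_killing_cols [seq col i U | i in S].
rewrite size_map -cardE in trQ.
have QAhat : Q *m Ahat = 0.
  rewrite mulmx_sumr big1// => i Si; rewrite -scalemxAr mulmxA QU ?mul0mx ?scaler0//.
  by apply/mapP; exists i; rewrite ?mem_enum.
rewrite (projector_pythagoras _ Qp).
have -> : Q *m (Ahat - M) = - (Q *m (M - F *m G)).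
  by rewrite !mulmxBr QAhat mulmxA QF mul0mx sub0r subr0.
rewrite sqfroN.
have QM := sqfro_projector_le (M - F *m G) Qp.
set P := 1%:M - Q in trQ *.
have Pp : orth_projector P := orth_projectorC Qp.
have sqfroP (Y : 'M[R]_n) c : 0 <= c ->
    (forall x : 'cV_n, sqfro (Y^T *m x) <= c * sqfro x) ->
    sqfro (P *m Y) <= c * (r%:R + #|S|%:R).
  move=> c0 hY; rewrite -sqfro_tr trmx_mul Pp.1.
  apply: le_trans (sqfro_mul_le P hY) _.
  by rewrite ler_wpM2l// sqfro_projector_trace.
have P1 : sqfro (P *m (Ahat - A)) <= tau ^+ 2 * (r%:R + #|S|%:R).
  by apply: sqfroP; [exact: sqr_ge0 | exact: truncation_residual].
have P2 : sqfro (P *m (A - M)) <= tau ^+ 2 * (r%:R + #|S|%:R).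
  apply: sqfroP => [|x]; first exact: sqr_ge0.
  rewrite symX; apply: le_trans (quadratic_to_operator symX k_gt0 normX x) _.
  apply: ler_wpM2r; first exact: sqfro_ge0.
  have k_le : k <= tau.
    by apply: le_trans k_tau _; rewrite ger_pMl// ler_pdivrMr// mul1r ler_nat.
  by rewrite lerXn2r// nnegrE ltW.
have P3 := sqfroD_le (P *m (Ahat - A)) (P *m (A - M)).
rewrite -mulmxDr addrA subrK in P3.
have := large_singular_values_count; rewrite -/S => cS.
have {cS} : tau ^+ 2 * #|S|%:R <= tau ^+ 2 * (17 * r%:R + 1024 / tau ^+ 2 * eps).
  by rewrite ler_wpM2l// sqr_ge0.
have -> : tau ^+ 2 * (17 * r%:R + 1024 / tau ^+ 2 * eps) =
   17 * (tau ^+ 2 * r%:R) + 1024 * eps by field; rewrite gt_eqF.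
rewrite !mulrDr in P1 P2; rewrite -/eps in QM => cS.
rewrite -mulrA.
lra.
Qed.

End Thresholding.

(** * Sub-Gaussian bound for independent Bernoulli variables *)

Section SubGaussian.
Context {R : realType}.

Lemma leq_exp2_fact (k : nat) : (2 ^ k * k`! <= (k.*2)`!)%N.
Proof.
elim: k => // k IH; rewrite doubleS !factS expnS.
rewrite mulnACA [leqRHS]mulnA; apply: leq_mul => //.
by rewrite mul2n -doubleS leq_pmulr.
Qed.

Lemma series_le_expR (x : R) (N : nat) : 0 <= x ->
  series (exp_coeff x) N <= expR x.
Proof.
move=> x0; apply: nondecreasing_cvgn_le; last exact: is_cvg_series_exp_coeff.
by apply: nondecreasing_series => n _ _; exact: exp_coeff_ge0.
Qed.

(** The Taylor coefficients compare termwise, as (2k)! >= 2^k k!. *)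
Lemma cosh_le_gauss (x : R) : expR x + expR (- x) <= 2 * expR (x ^+ 2 / 2).
Proof.
pose S := series (exp_coeff x) \+ series (exp_coeff (- x)).
have cvS : S n @[n --> \oo] --> expR x + expR (- x).
  by apply: cvgD; exact: is_cvg_series_exp_coeff.
have cv2 : (S \o double) n @[n --> \oo] --> expR x + expR (- x).
  apply: cvg_comp cvS => A [N _ NA]; exists N => // n /= Nn.
  by apply: NA => /=; rewrite -addnn; exact: leq_trans (leq_addr _ _).
have le_n n : S n.*2 <= 2 * series (exp_coeff (x ^+ 2 / 2)) n.
  elim: n => [|n IH]; first by rewrite /S /= !seriesEnat /= !big_geq// mulr0 addr0.
  move: IH; rewrite /S doubleS /= !seriesEnat /= !big_nat_recr//= => IH.
  set a := \sum_(0 <= _ < _) _ in IH *; set b := \sum_(0 <= _ < _) _ in IH *.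
  set c := \sum_(0 <= _ < _) _ in IH *.
  rewrite /exp_coeff /=.
  have -> : (- x) ^+ n.*2 = x ^+ n.*2.
    by rewrite exprNn -mul2n exprM sqrrN expr1n expr1n mul1r.
  have -> : (- x) ^+ n.*2.+1 = - x ^+ n.*2.+1.
    by rewrite exprNn exprS -mul2n exprM sqrrN expr1n expr1n mulr1 mulN1r.
  have : x ^+ n.*2 / (n.*2)`!%:R <= (x ^+ 2 / 2) ^+ n / n`!%:R.
    rewrite expr_div_n -exprM mul2n -mulrA -invfM.
    rewrite ler_wpM2l//; first by rewrite -mul2n exprM exprn_ge0// sqr_ge0.
    rewrite lef_pV2 ?posrE ?mulr_gt0 ?exprn_gt0 ?ltr0n ?fact_gt0//.
    by rewrite -natrX -natrM ler_nat leq_exp2_fact.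
  rewrite mulNr; lra.
rewrite -(cvg_lim _ cv2)//; apply: limr_le; first by apply/cvg_ex; eexists; exact: cv2.
near=> n => /=.
apply: le_trans (le_n n) _; rewrite ler_wpM2l// series_le_expR//.
by rewrite divr_ge0// sqr_ge0.
Unshelve. all: by end_near. Qed.

(** Symmetrization: if b' is an independent copy of b, Jensen's inequality bounds
    the left side by E exp(l (b - b')) = 1 + 2 p (1 - p) (cosh l - 1), and
    p (1 - p) <= 1/4 bounds this by (1 + cosh l) / 2 = cosh(l / 2)^2. *)
Lemma bernoulli_mgf (p l : R) : 0 <= p <= 1 ->
  p * expR (l * (1 - p)) + (1 - p) * expR (l * (0 - p)) <= expR (l ^+ 2 / 4).
Proof.
move=> /andP[p0 p1].
set E := expR (l * (0 - p)).
have E0 : 0 < E by exact: expR_gt0.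
have -> : expR (l * (1 - p)) = expR l * E by rewrite -expRD; congr expR; ring.
(* the tangent of exp at - l p, read at 0 and at - l *)
have jensen : E <= 1 - p + p * expR (- l).
  have h1 : E * (1 + l * p) <= 1.
    apply: (@le_trans _ _ (E * expR (l * p))).
      by rewrite ler_pM2l// expR_ge1Dx.
    by rewrite -expRD (_ : l * (0 - p) + l * p = 0) ?expR0//; ring.
  have h2 : E * (1 + (l * p - l)) <= expR (- l).
    apply: (@le_trans _ _ (E * expR (l * p - l))).
      by rewrite ler_pM2l// expR_ge1Dx.
    by rewrite -expRD (_ : l * (0 - p) + (l * p - l) = - l)//; ring.
  have : (1 - p) * (E * (1 + l * p)) <= (1 - p) * 1 by rewrite ler_wpM2l//; lra.
  have : p * (E * (1 + (l * p - l))) <= p * expR (- l) by rewrite ler_wpM2l//.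
  lra.
have l0 : 0 < expR l by exact: expR_gt0.
have ll : expR l * expR (- l) = 1 by rewrite -expRD subrr expR0.
have hl : expR l + expR (- l) <= 4 * expR (l ^+ 2 / 4) - 2.
  have lE : l = l / 2 + l / 2 by field.
  have l2E : l ^+ 2 / 4 = (l / 2) ^+ 2 / 2 + (l / 2) ^+ 2 / 2 by field.
  have h := cosh_le_gauss (l / 2).
  rewrite l2E [in expR l]lE [in expR (- l)]lE opprD !expRD.
  move: h; set u := expR (l / 2); set v := expR (- (l / 2)); set w := expR _ => h.
  have uv : u * v = 1 by rewrite -expRD subrr expR0.
  have u0 : 0 < u by exact: expR_gt0.
  have v0 : 0 < v by exact: expR_gt0.
  have : (u + v) * (u + v) <= (2 * w) * (2 * w) by apply: ler_pM => //; lra.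
  have -> : (u + v) * (u + v) = u * u + v * v + 2 * (u * v) by ring.
  by rewrite uv; lra.
have s2 : 2 <= expR l + expR (- l).
  have : 0 <= (expR l - 1) ^+ 2 * expR (- l) by rewrite mulr_ge0 ?sqr_ge0 ?expR_ge0.
  have -> : (expR l - 1) ^+ 2 * expR (- l) =
    expR l * (expR l * expR (- l)) - 2 * (expR l * expR (- l)) + expR (- l) by ring.
  by rewrite ll; lra.
apply: (@le_trans _ _ ((p * expR l + (1 - p)) * (1 - p + p * expR (- l)))).
  have -> : p * (expR l * E) + (1 - p) * E = (p * expR l + (1 - p)) * E by ring.
  by rewrite ler_wpM2l// addr_ge0 ?subr_ge0// mulr_ge0// ltW.
have -> : (p * expR l + (1 - p)) * (1 - p + p * expR (- l)) =
  p ^+ 2 * (expR l * expR (- l)) + (1 - p) ^+ 2 +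
  p * (1 - p) * (expR l + expR (- l)) by ring.
rewrite ll.
have pp : p * (1 - p) <= 1 / 4 by have := sqr_ge0 (p - 1 / 2); lra.
have : p * (1 - p) * (expR l + expR (- l) - 2) <= 1 / 4 * (expR l + expR (- l) - 2).
  by rewrite ler_wpM2r//; lra.
lra.
Qed.

Variables (I : finType) (P : pred I).

(** The outcomes are set to [false] outside of [P], so that a family of bits
    indexed by [P] is represented exactly once. *)
Definition outcomes : {pred {ffun I -> bool}} := pfamily false P (fun=> predT).

Definition bernoulli_weight (p : I -> R) (f : {ffun I -> bool}) : R :=
  \prod_(i | P i) (if f i then p i else 1 - p i).

(** A product of functions of independent variables has the product of their
    expectations as its expectation. *)
Lemma sum_bernoulli_weight (p : I -> R) (g : I -> bool -> R) :
  \sum_(f in outcomes) bernoulli_weight p f * \prod_(i | P i) g i (f i) =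
  \prod_(i | P i) (p i * g i true + (1 - p i) * g i false).
Proof.
under [RHS]eq_bigr => i _.
  rewrite (_ : _ + _ = \sum_(b : bool) (if b then p i else 1 - p i) * g i b); last first.
    by rewrite big_bool.
  over.
rewrite (big_distr_big_dep false) /=; apply: eq_big => //= f _.
by rewrite -big_split.
Qed.

Lemma bernoulli_weight_ge0 (p : I -> R) f :
  (forall i, P i -> 0 <= p i <= 1) -> 0 <= bernoulli_weight p f.
Proof.
move=> p01; apply: prodr_ge0 => i Pi; have /andP[p0 p1] := p01 i Pi.
by case: ifP; rewrite ?subr_ge0.
Qed.

(** Markov's inequality for exp(l S), where S is the weighted sum. *)
Lemma bernoulli_chernoff (p c : I -> R) (l t : R) :
  (forall i, P i -> 0 <= p i <= 1) -> 0 <= l ->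
  \sum_(f in outcomes | t < \sum_(i | P i) c i * ((f i)%:R - p i))
    bernoulli_weight p f <=
  expR (l ^+ 2 / 4 * (\sum_(i | P i) c i ^+ 2) - l * t).
Proof.
move=> p01 l0.
pose L (f : {ffun I -> bool}) := \sum_(i | P i) c i * ((f i)%:R - p i).
have mgf : \sum_(f in outcomes) bernoulli_weight p f * expR (l * L f) <=
    expR (l ^+ 2 / 4 * (\sum_(i | P i) c i ^+ 2)).
  under eq_bigr => f _ do rewrite /L mulr_sumr expR_sum.
  rewrite (sum_bernoulli_weight p (fun i b => expR (l * (c i * (b%:R - p i))))).
  rewrite mulr_sumr expR_sum; apply: ler_prod => i Pi; apply/andP; split.
    have /andP[p0 p1] := p01 i Pi.
    by rewrite addr_ge0// mulr_ge0 ?expR_ge0// subr_ge0.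
  rewrite ![l * (c i * _)]mulrA.
  rewrite (_ : l ^+ 2 / 4 * c i ^+ 2 = (l * c i) ^+ 2 / 4); last by ring.
  exact: bernoulli_mgf (p01 i Pi).
rewrite expRB ler_pdivlMr ?expR_gt0// mulr_suml.
apply: le_trans mgf; rewrite [leRHS](bigID (fun f => t < L f)) /=.
apply: ler_wpDr.
  by apply: sumr_ge0 => f _; rewrite mulr_ge0 ?expR_ge0// bernoulli_weight_ge0.
apply: ler_sum => f /andP[_ tL]; rewrite ler_wpM2l ?bernoulli_weight_ge0//.
by rewrite ler_expR ler_wpM2l// ltW.
Qed.

End SubGaussian.

(** The gain of the Chernoff bound per vertex, against the factor 54 by which the
    number of lattice points grows; it comes from 1 + x <= exp x at
    x = 3200 / 729 / 2^6 after six squarings. *)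
Lemma expR_ge60 (R : realType) : 60 <= expR (3200 / 729 : R).
Proof.
have sq (a b c : R) : 0 <= a -> a <= b -> c <= a ^+ 2 -> c <= b ^+ 2.
  move=> a0 ab /le_trans; apply; rewrite lerXn2r// nnegrE.
  exact: le_trans ab.
have ex2 (x : R) : expR x = expR (x / 2) ^+ 2.
  by rewrite -expRM_natl; congr expR; field.
pose e k : R := expR (3200 / 729 / 2 ^+ k).
have eS k : e k = e k.+1 ^+ 2.
  by rewrite /e ex2; congr (expR _ ^+ 2); rewrite exprS; field.
have e6 : 2137 / 2000 <= e 6%N.
  apply: le_trans (expR_ge1Dx _); lra.
have e5 : 1141 / 1000 <= e 5%N by rewrite eS; apply: sq e6 _; clear -R; lra.
have e4 : 13 / 10 <= e 4%N by rewrite eS; apply: sq e5 _; clear -R; lra.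
have e3 : 42 / 25 <= e 3%N by rewrite eS; apply: sq e4 _; clear -R; lra.
have e2 : 14 / 5 <= e 2%N by rewrite eS; apply: sq e3 _; clear -R; lra.
have e1 : 39 / 5 <= e 1%N by rewrite eS; apply: sq e2 _; clear -R; lra.
have -> : expR (3200 / 729) = e 0%N by rewrite /e expr0 divr1.
by rewrite eS; apply: sq e1 _; clear -R; lra.
Qed.

(** * Lattice points suffice to control the noise *)

Section Net.
Context {R : realType} {n : nat}.
Implicit Types (X : 'M[R]_n) (y : 'cV[R]_n).

(** The term in t^2 is X i i, so that the form is affine in each coordinate. *)
Lemma mxform_coordinate X y t i : X^T = X -> X i i = 0 ->
  mxform X (y + t *: delta_mx i 0) (y + t *: delta_mx i 0) =
  mxform X y y + 2 * t * (X *m y) i 0.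
Proof.
move=> XT Xii; rewrite !(mxformDl, mxformDr, mxformZl, mxformZr).
rewrite (mxform_sym XT y (delta_mx i 0)).
have e1 : mxform X (delta_mx i 0) y = (X *m y) i 0.
  by rewrite /mxform trmx_delta -mulmxA -rowE mxE.
have -> : mxform X (delta_mx i 0) (delta_mx i 0) = 0.
  by rewrite /mxform trmx_delta -rowE -colE !mxE.
by rewrite e1; ring.
Qed.

(** An affine function on an interval is largest at an endpoint: the coordinates
    are moved one after the other to the integer below or above, according to
    the sign of the slope. *)
Lemma mxform_rounding X y : X^T = X -> (forall i, X i i = 0) ->
  exists z : 'I_n -> int,
    (forall i, `|(z i)%:~R - y i 0| <= 1) /\
    mxform X y y <= mxform X (\col_i (z i)%:~R) (\col_i (z i)%:~R).
Proof.
move=> XT X0.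
suff [y' [y'z y'y qy]] : exists y' : 'cV[R]_n,
    [/\ forall i : 'I_n, exists k : int, y' i 0 = k%:~R,
        forall i, `|y' i 0 - y i 0| <= 1 & mxform X y y <= mxform X y' y'].
  have [z zE] := choice y'z; exists z; split=> [i|].
    by rewrite -zE.
  rewrite (_ : \col_i _ = y')//.
  by apply/matrixP => i j; rewrite mxE -zE ord1.
(* the first m coordinates are rounded, the others are still those of y *)
suff /(_ n) [y' [y'z _ y'y qy]] : forall m, exists y' : 'cV[R]_n,
    [/\ forall i : 'I_n, (i < m)%N -> exists k : int, y' i 0 = k%:~R,
        forall i : 'I_n, (m <= i)%N -> y' i 0 = y i 0,
        forall i, `|y' i 0 - y i 0| <= 1 & mxform X y y <= mxform X y' y'].
  by exists y'; split=> // i; exact: y'z.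
elim=> [|m [y' [y'z y'eq y'y qy]]].
  by exists y; split=> // i; rewrite subrr normr0.
have [nm|mn] := leqP n m.
  exists y'; split=> // i ilt; last first.
    by have := ltn_ord i; rewrite ltnNge (leq_trans nm (ltnW ilt)).
  by apply: y'z; exact: leq_trans (ltn_ord i) nm.
pose i0 := Ordinal mn.
have fl := floor_le (y i0 0); have fs := floorD1_gt (y i0 0).
set fy := Num.floor (y i0 0) in fl fs.
have [k [k1 kq]] : exists k : int, `|k%:~R - y i0 0| <= 1 /\
    0 <= (k%:~R - y i0 0) * (X *m y') i0 0.
  have [h|h] := leP 0 ((X *m y') i0 0).
    exists (fy + 1); split; first by rewrite ler_norml; apply/andP; split; lra.
    by rewrite mulr_ge0// subr_ge0 ltW.
  rewrite rmorphD /= in fs; exists fy; split.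
    by rewrite ler_norml; apply/andP; split; lra.
  by rewrite mulr_le0 ?subr_le0// ltW.
exists (y' + (k%:~R - y i0 0) *: delta_mx i0 0).
have coord i : (y' + (k%:~R - y i0 0) *: delta_mx i0 0) i 0 =
    if i == i0 then k%:~R else y' i 0.
  rewrite !mxE eqxx andbT; case: eqP => [->|_]; last by rewrite mulr0 addr0.
  by rewrite mulr1 y'eq// addrC subrK.
split=> [i|i|i|].
- rewrite ltnS leq_eqVlt coord; case: (eqVneq i i0) => [_ _|ii0]; first by exists k.
  case/orP => [/eqP im|/y'z//].
  by rewrite (_ : i = i0) ?eqxx// in ii0; apply: val_inj.
- move=> mi; rewrite coord; case: eqVneq => [ii0|_].
    by move: mi; rewrite ii0 /= ltnn.
  by apply: y'eq; exact: ltnW.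
- by rewrite coord; case: eqVneq => [->|_].
- rewrite mxform_coordinate//; apply: le_trans qy _.
  by rewrite lerDl -mulrA mulr_ge0.
Qed.

(** The integer vectors of norm at most 9 sqrt n, a coordinate being given by its
    sign and its absolute value.  Zero has two signs, so that some vectors are
    listed several times, which is harmless in a union bound. *)
Definition lattice_ball : pred {ffun 'I_n -> bool * 'I_(9 * n).+1} :=
  fun f => (\sum_i (f i).2 ^ 2 <= 81 * n)%N.

Definition lattice_vector (f : {ffun 'I_n -> bool * 'I_(9 * n).+1}) : 'cV[R]_n :=
  \col_i ((-1) ^+ (f i).1 * (f i).2%:R).

Lemma lattice_vector_onto (z : 'I_n -> int) :
  \sum_i (z i)%:~R ^+ 2 <= 81 * n%:R :> R ->
  exists2 f, f \in lattice_ball & lattice_vector f = \col_i (z i)%:~R.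
Proof.
move=> z81.
have absE i : (`|z i|%N%:R : R) ^+ 2 = (z i)%:~R ^+ 2.
  by rewrite natr_absz intr_norm real_normK// num_real.
have le9 i : (`|z i| < (9 * n).+1)%N.
  rewrite ltnS -(@ler_nat R) -(@ler_pXn2r _ 2)// ?nnegrE// absE.
  apply: (@le_trans _ _ (81 * n%:R)).
    by apply: le_trans z81; rewrite (bigD1 i)//= lerDl sumr_ge0// => j _; rewrite sqr_ge0.
  rewrite natrM exprMn -natrX ler_wpM2l// -natrX ler_nat.
  by rewrite expnS expn1 leq_pmulr// (leq_ltn_trans _ (ltn_ord i)).
exists [ffun i => (z i < 0, inord `|z i|%N)].
  rewrite unfold_in -(@ler_nat R) natr_sum natrM; apply: le_trans z81.
  by apply: ler_sum => i _; rewrite ffunE /= inordK// natrX absE.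
apply/matrixP => i j; rewrite !mxE ffunE /= inordK//.
by rewrite {3}[z i]intEsign rmorphM /= rmorph_sign.
Qed.

(** By (|z| - 9)^2 >= 0, the points of the ball have sum |z_i| <= 9 n.  Each of
    them thus has weight at least (8/9)^(9 n) when z has weight
    (8/9)^(sum |z_i|), while the total weight is a product of n geometric sums
    at most 18.  Finally (9/8)^9 < 3. *)
Lemma card_lattice_ball : #|lattice_ball|%:R <= 54 ^+ n :> R.
Proof.
pose q : R := 8 / 9.
have q0 : 0 < q by rewrite divr_gt0.
have q1 : q <= 1 by rewrite ler_pdivrMr// mul1r ler_nat.
have geo : \sum_(bk : bool * 'I_(9 * n).+1) q ^+ bk.2 <= 18.
  rewrite -(pair_big predT predT (fun (b : bool) (k : 'I_(9 * n).+1) => q ^+ k)) /=.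
  rewrite sumr_const card_bool.
  have : (1 - q) * \sum_(k < (9 * n).+1) q ^+ k <= 1.
    by rewrite -opprB mulNr -subrX1 opprB gerBl exprn_ge0// ltW.
  by rewrite /q; set s := \sum_(_ < _) _; lra.
have tot : \sum_(f : {ffun 'I_n -> bool * 'I_(9 * n).+1}) \prod_i q ^+ (f i).2 <= 18 ^+ n.
  rewrite -(bigA_distr_bigA (fun (i : 'I_n) (bk : bool * 'I_(9 * n).+1) => q ^+ bk.2)).
  rewrite prodr_const card_ord lerXn2r ?nnegrE//.
  by apply: sumr_ge0 => bk _; rewrite exprn_ge0// ltW.
have lower f : f \in lattice_ball -> q ^+ (9 * n) <= \prod_i q ^+ (f i).2.
  rewrite unfold_in => f81; rewrite prodrXr; apply: ler_wiXn2l => //; first exact: ltW.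
  have h : (\sum_i (18 * (f i).2) <= \sum_i ((f i).2 ^ 2 + 81))%N.
    apply: leq_sum => i _; have [le _] := nat_Cauchy 9 (f i).2.
    by rewrite mulnA [leqRHS]addnC in le *.
  move: h; rewrite -big_distrr big_split /= sum_nat_const card_ord => h.
  have {h} := leq_trans h (leq_add f81 (leqnn _)).
  by set k := (\sum_i _)%N; lia.
have : #|lattice_ball|%:R * q ^+ (9 * n) <= 18 ^+ n.
  apply: le_trans tot; rewrite (bigID [in lattice_ball]) /=; apply: ler_wpDr.
    by apply: sumr_ge0 => g _; apply: prodr_ge0 => i _; rewrite exprn_ge0// ltW.
  by rewrite mulrC mulr_natr -sumr_const; apply: ler_sum => f; exact: lower.
move=> h; rewrite (_ : 54 = 18 * 3)//; last by ring.
rewrite exprMn -ler_pdivrMr ?exprn_gt0//; apply: le_trans h.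
rewrite ler_wpM2l// exprM -exprVn lerXn2r ?nnegrE ?exprn_ge0 ?ltW//.
rewrite /q; lra.
Qed.

(** By homogeneity y may have norm 8 sqrt n.  Rounding then moves it by at most
    sqrt n, into the ball of radius 9 sqrt n. *)
Lemma lattice_controls_form X (k : R) : X^T = X -> (forall i, X i i = 0) ->
  (forall f, f \in lattice_ball ->
     `|mxform X (lattice_vector f) (lattice_vector f)| <= 64 * k * n%:R) ->
  forall y, `|mxform X y y| <= k * sqfro y.
Proof.
move=> XT X0 hL y.
have [y0|y0] := eqVneq (sqfro y) 0.
  by rewrite y0 mulr0 (sqfro_eq0 y0) /mxform mulmx0 mxE normr0.
have sy : 0 < sqfro y by rewrite lt_def y0 sqfro_ge0.
pose a := Num.sqrt (64 * n%:R / sqfro y).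
have a2 : a ^+ 2 = 64 * n%:R / sqfro y.
  by rewrite sqr_sqrtr// divr_ge0// ?ltW// mulr_ge0.
have n0 : (0 < n)%N.
  case: (posnP n) => // nE; case/eqP: y0; rewrite /sqfro big1// => i _.
  by have := ltn_ord i; rewrite {2}nE.
have a0 : 0 < a ^+ 2 by rewrite a2 divr_gt0// mulr_gt0// ltr0n.
have sqay : sqfro (a *: y) = 64 * n%:R by rewrite sqfroZ a2 divfK.
have main Y : Y^T = Y -> (forall i, Y i i = 0) ->
    (forall f, f \in lattice_ball ->
       mxform Y (lattice_vector f) (lattice_vector f) <= 64 * k * n%:R) ->
    mxform Y y y <= k * sqfro y.
  move=> YT Y0 hY.
  have [z [zy qz]] := mxform_rounding (a *: y) YT Y0.
  have [|f fL fz] := lattice_vector_onto (z := z).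
    have : \sum_i (z i)%:~R ^+ 2 <=
        \sum_i (9 / 8 * (a *: y) i 0 ^+ 2 + 9 : R).
      apply: ler_sum => i _; have := zy i; set u := _ i 0; set v := _%:~R => uv.
      have : (v - u) ^+ 2 <= 1 by rewrite -real_normK ?num_real// expr_le1.
      (* the weights 9/8 and 9 turn |u|^2 = 64 n, |v - u|^2 <= n into 81 n *)
      by have := sqr_ge0 (u / 8 - (v - u)); lra.
    rewrite big_split /= -mulr_sumr sumr_const card_ord.
    have -> : \sum_i (a *: y) i 0 ^+ 2 = sqfro (a *: y).
      by apply: eq_bigr => i _; rewrite big_ord1.
    by rewrite sqay -mulr_natr; lra.
  have := le_trans qz; rewrite -fz => /(_ _ (hY _ fL)).
  rewrite mxformZl mxformZr mulrA -expr2 => h.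
  rewrite -(ler_pM2l a0); apply: le_trans h _.
  by rewrite mulrCA -sqfroZ sqay; lra.
rewrite ler_norml lerNl; apply/andP; split; last first.
  by apply: main => // f /hL; rewrite ler_norml => /andP[].
rewrite -mxformN; apply: main => [|i|f /hL].
- by rewrite linearN /= XT.
- by rewrite mxE X0 oppr0.
- by rewrite mxformN ler_norml lerNl => /andP[].
Qed.

Definition upper (ij : 'I_n * 'I_n) : bool := (ij.1 < ij.2)%N.

Lemma sum_upper (F : 'I_n -> 'I_n -> R) : (forall i j, F i j = F j i) ->
  \sum_i \sum_j F i j =
  \sum_(ij | upper ij) 2 * F ij.1 ij.2 + \sum_i F i i.
Proof.
move=> FC; rewrite pair_big /= (bigID upper) /=.
rewrite (bigID (fun ij => upper (ij.2, ij.1)) (fun ij => ~~ upper ij)) /=.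
rewrite addrA; congr (_ + _); last first.
  rewrite (eq_bigl (fun ij => ij.2 == ij.1)) => [|[i j]]; last first.
    by rewrite /upper /= -!leqNgt -eqn_leq.
  rewrite -(pair_big_dep predT (fun i j => j == i) F) /=.
  by apply: eq_bigr => i _; rewrite big_pred1_eq.
rewrite [X in _ + X](reindex_onto (fun ij => (ij.2, ij.1))
  (fun ij => (ij.2, ij.1)))/=; last by case.
rewrite [X in _ + X](eq_bigl upper) => [|[i j]]; last first.
  by rewrite /upper /= eqxx andbT; case: ltngtP.
rewrite -big_split; apply: eq_bigr => -[i j] _ /=.
by rewrite (FC j i); ring.
Qed.

End Net.

(** * Concentration of the noise for a fixed probability matrix *)

Section Concentration.
Context {R : realType} {n : nat}.
Variable p : 'I_n * 'I_n -> R.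
Hypothesis p01 : forall ij, upper ij -> 0 <= p ij <= 1.

Definition lattice_noise (g : {ffun 'I_n -> bool * 'I_(9 * n).+1})
    (f : {ffun 'I_n * 'I_n -> bool}) : R :=
  \sum_(ij | upper ij)
    2 * lattice_vector g ij.1 0 * lattice_vector g ij.2 0 * ((f ij)%:R - p ij).

(** The spectral norm exceeds (15/4) sqrt n, as seen from the lattice points that
    arise from vectors of squared norm 64 n. *)
Definition large_noise f : bool :=
  [exists g in lattice_ball,
    64 * (15 / 4 * Num.sqrt n%:R) * n%:R < `|lattice_noise g f|].


(** The coefficients 2 z_i z_j have sum of squares at most
    2 (sum z_i^2)^2 <= 2 (81 n)^2. *)
Lemma lattice_noise_chernoff g (t l : R) : g \in lattice_ball -> 0 <= l ->
  \sum_(f in outcomes upper | t < `|lattice_noise g f|) bernoulli_weight upper p f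
  <= 2 * expR (l ^+ 2 * ((81 * n%:R) ^+ 2) / 2 - l * t).
Proof.
move=> gL l0.
pose c ij : R := 2 * lattice_vector g ij.1 0 * lattice_vector g ij.2 0.
have var : \sum_(ij | upper ij) c ij ^+ 2 <= 2 * ((81 * n%:R) ^+ 2).
  pose w i : R := lattice_vector g i 0 ^+ 2.
  have sw : \sum_i w i <= 81 * n%:R.
    move: gL; rewrite unfold_in -(@ler_nat R) natr_sum natrM; apply: le_trans.
    by apply: ler_sum => i _; rewrite /w mxE exprMn sqrr_sign mul1r natrX.
  have w0 i : 0 <= w i by exact: sqr_ge0.
  have := @sum_upper R n (fun i j => w i * w j) (fun i j => mulrC _ _).
  have -> : \sum_i \sum_j w i * w j = (\sum_i w i) ^+ 2.
    by rewrite expr2 mulr_suml; apply: eq_bigr => i _; rewrite mulr_sumr.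
  have d0 : 0 <= \sum_i w i * w i by apply: sumr_ge0 => i _; rewrite mulr_ge0.
  have -> : \sum_(ij | upper ij) c ij ^+ 2 =
      2 * \sum_(ij | upper ij) 2 * (w ij.1 * w ij.2).
    by rewrite mulr_sumr; apply: eq_bigr => -[i j] _; rewrite /c /w /=; ring.
  move=> sE; rewrite ler_pM2l//.
  have : (\sum_i w i) ^+ 2 <= (81 * n%:R) ^+ 2.
    by rewrite lerXn2r ?nnegrE ?mulr_ge0// sumr_ge0.
  by lra.
have one (c' : 'I_n * 'I_n -> R) : (forall ij, c' ij ^+ 2 = c ij ^+ 2) ->
    \sum_(f in outcomes upper | t < \sum_(ij | upper ij) c' ij * ((f ij)%:R - p ij))
       bernoulli_weight upper p f <=
    expR (l ^+ 2 * ((81 * n%:R) ^+ 2) / 2 - l * t).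
  move=> c'E; apply: le_trans (bernoulli_chernoff c' t p01 l0) _.
  rewrite ler_expR lerD2r (eq_bigr (fun ij => c ij ^+ 2)) => [|ij _]; last exact: c'E.
  have l4 : 0 <= l ^+ 2 / 4 by rewrite divr_ge0// sqr_ge0.
  by have := ler_wpM2l l4 var; lra.
have pos := one c (fun=> erefl).
have neg := one (fun ij => - c ij) (fun ij => sqrrN _).
rewrite mulr_natl mulr2n; apply: le_trans (lerD pos neg).
rewrite [X in X + _]big_mkcondr [X in _ + X]big_mkcondr big_mkcondr -big_split /=.
apply: ler_sum => f _.
have w0 := bernoulli_weight_ge0 f p01.
have -> : \sum_(ij | upper ij) - c ij * ((f ij)%:R - p ij) = - lattice_noise g f.
  by rewrite /lattice_noise -sumrN; apply: eq_bigr => ij _; rewrite mulNr.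
rewrite -/(lattice_noise g f); case: (lerP _ _) => //= [_|].
  by apply: addr_ge0; case: ifP.
rewrite lter_normr orbC => /orP[|] ->.
  by rewrite lerDr; case: ifP.
by rewrite lerDl; case: ifP.
Qed.

(** Union bound over the lattice ball: 54^n points, and an exponent
    - (3200/729) n for each of the two signs. *)
Lemma large_noise_weight :
  \sum_(f in outcomes upper | large_noise f) bernoulli_weight upper p f
  <= 2 * (9 / 10) ^+ n.
Proof.
set t := 64 * (15 / 4 * Num.sqrt n%:R) * n%:R : R.
apply: (@le_trans _ _ (\sum_(g in lattice_ball)
    \sum_(f in outcomes upper | t < `|lattice_noise g f|) bernoulli_weight upper p f)).
  under [leRHS]eq_bigr do rewrite big_mkcondr.
  rewrite exchange_big big_mkcondr /=; apply: ler_sum => f _.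
  have w0 := bernoulli_weight_ge0 f p01.
  case: ifPn => [/existsP[g /andP[gL tg]]|_].
    rewrite (bigD1 g)//= tg lerDl; apply: sumr_ge0 => g' _; by case: ifP.
  by apply: sumr_ge0 => g' _; case: ifP.
have s0 : 0 <= Num.sqrt n%:R :> R by exact: sqrtr_ge0.
have s2 : Num.sqrt n%:R ^+ 2 = n%:R :> R by rewrite sqr_sqrtr.
(* the value of l that minimises l ^+ 2 * (81 * n) ^+ 2 / 2 - l * t *)
pose l : R := 240 / 81 ^+ 2 / Num.sqrt n%:R.
have l0 : 0 <= l.
  by apply: divr_ge0; [apply: divr_ge0; [exact: ler0n|exact: sqr_ge0]|exact: s0].
have lt_exp : 2 * expR (l ^+ 2 * ((81 * n%:R) ^+ 2) / 2 - l * t) <= 2 / 60 ^+ n.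
  have [n0|n0] := posnP n.
    by rewrite /t n0 !mulr0 expr0n /= mulr0 mul0r subrr expR0 expr0 divr1 mulr1.
  have sn0 : Num.sqrt n%:R != 0 :> R by rewrite sqrtr_eq0 -ltNge ltr0n.
  have -> : l ^+ 2 * ((81 * n%:R) ^+ 2) / 2 - l * t = - (n%:R * (3200 / 729)).
    rewrite /l /t; move: s2 sn0; set s := Num.sqrt _ => <- sn0.
    by field.
  rewrite expRN expRM_natl ler_pM2l// lef_pV2 ?posrE ?exprn_gt0 ?expR_gt0//.
  by rewrite lerXn2r ?nnegrE ?expR_ge0// expR_ge60.
apply: (@le_trans _ _ (\sum_(g in @lattice_ball n) 2 / 60 ^+ n)).
  by apply: ler_sum => g gL; apply: le_trans lt_exp; exact: lattice_noise_chernoff.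
rewrite sumr_const -[leLHS]mulr_natl mulrCA ler_pM2l// -exprVn.
apply: (@le_trans _ _ (54 ^+ n * 60^-1 ^+ n)).
  by rewrite ler_wpM2r ?exprn_ge0// card_lattice_ball.
by rewrite -exprMn lerXn2r ?nnegrE//; lra.
Qed.

(** The link with matrices: [f] holds the entries of the adjacency matrix above
    the diagonal. *)
Lemma small_noise_norm (X : 'M[R]_n) (f : {ffun 'I_n * 'I_n -> bool}) :
  X^T = X -> (forall i, X i i = 0) ->
  (forall ij, upper ij -> X ij.1 ij.2 = (f ij)%:R - p ij) ->
  ~~ large_noise f ->
  forall y, `|mxform X y y| <= 15 / 4 * Num.sqrt n%:R * sqfro y.
Proof.
move=> XT X0 XE nf; apply: lattice_controls_form => // g gL.
rewrite leNgt; apply: contra nf => tg; apply/existsP; exists g; rewrite gL /=.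
rewrite (_ : lattice_noise g f = mxform X (lattice_vector g) (lattice_vector g))//.
rewrite mxformE sum_upper => [|i j]; last first.
  have -> : X i j = X j i by rewrite -[in LHS]XT mxE.
  by ring.
rewrite [X in _ = _ + X]big1 ?addr0 => [|i _]; last by rewrite X0 mulr0 mul0r.
by apply: eq_bigr => ij uij; rewrite XE//; ring.
Qed.

End Concentration.

(** * Integrals, and the law of the latent positions *)

Section IntegralBound.
Context d (T : measurableType d) (R : realType).
Variable mu : {measure set T -> \bar R}.
Import HBNNSimple.

(** The integral of a nonnegative function is the supremum of those of the simple
    functions below it, and each of these is compared with [g].  In this form the
    bound applies to the loss of an estimator, about whose dependence on the
    sample point nothing is known. *)
Lemma ge0_le_integral_ae (f g : T -> \bar R) :
  (forall x, 0 <= f x)%E -> (forall x, 0 <= g x)%E -> measurable_fun setT g ->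
  {ae mu, forall x, (f x <= g x)%E} ->
  (\int[mu]_x f x <= \int[mu]_x g x)%E.
Proof.
move=> f0 g0 mg fg; rewrite ge0_integralTE//; apply: ge_ereal_sup => _ [h /= hf <-].
rewrite -integralT_nnsfun; apply: ae_ge0_le_integral => //.
- by move=> x _; rewrite lee_fin.
- exact/measurable_EFinP.
- by apply: filterS fg => x + _; exact: le_trans.
Qed.

Lemma ge0_le_integral_dom (D : set T) (f g : T -> \bar R) : measurable D ->
  (forall x, D x -> 0 <= f x)%E -> measurable_fun D g ->
  (forall x, D x -> (f x <= g x)%E) ->
  (\int[mu]_(x in D) f x <= \int[mu]_(x in D) g x)%E.
Proof.
move=> mD f0 mg fg; rewrite integral_mkcond [leRHS]integral_mkcond.
have g0 x : D x -> (0 <= g x)%E by move=> Dx; exact: le_trans (f0 _ Dx) (fg _ Dx).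
apply: ge0_le_integral_ae.
- exact: erestrict_ge0.
- exact: erestrict_ge0.
- exact/(measurable_restrictT _ _).1.
- by apply: aeW => x; exact: lee_restrict.
Qed.

End IntegralBound.

Section UniformSample.
Context {R : realType} {d : measure_display} {T : measurableType d}.
Variables (P : probability T R) (n : nat) (xi : 'I_n -> {RV P >-> R}).
Hypothesis xi_iid : iid_uniform01 xi.
Local Notation mu := (@lebesgue_measure R).
Local Notation I01 := (`[0, 1]%classic : set R).
Local Notation U := (uniform_prob (@ltr01 R)).
Local Open Scope ereal_scope.

Lemma integral_uniform01 (g : R -> \bar R) : measurable_fun setT g ->
  (forall x, 0 <= g x) -> \int[U]_x g x = \int[mu]_(x in I01) g x.
Proof. by move=> mg g0; rewrite integral_uniform// subr0 invr1 mul1e. Qed.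

Lemma uniform01_itv : U I01 = 1.
Proof. by rewrite /uniform_prob integral_uniform_pdf1. Qed.

Lemma sample_in_itv : P [set t | forall i, I01 (xi i t)] = 1.
Proof.
rewrite (xi_iid.2 (fun=> I01))// big1// => i _.
by have := xi_iid.1 i I01; rewrite uniform01_itv; apply.
Qed.

Lemma expectation_one i (g : R -> \bar R) : measurable_fun setT g ->
  (forall x, 0 <= g x) ->
  \int[P]_t g (xi i t) = \int[mu]_(x in I01) g x.
Proof.
move=> mg g0; rewrite -integral_uniform01//.
(* the space R on which the Lebesgue and uniform measures are defined *)
have mxi : measurable_fun setT (xi i : T -> measurableTypeR R).
  exact: (@measurable_funPT _ _ _ _ (xi i)).
rewrite -[LHS](@ge0_integral_pushforward _ _ _ (measurableTypeR R) R _ mxi P setT g)//.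
apply: (eq_measure_integral U) => A mA _.
by have := xi_iid.1 i A mA.
Qed.

(** Two distinct latent positions have the product law, because measures on a
    product are determined by rectangles; then Tonelli's theorem applies. *)
Lemma expectation_two i j (g : R * R -> \bar R) : i != j ->
  measurable_fun setT g -> (forall x, 0 <= g x) ->
  \int[P]_t g (xi i t, xi j t) =
  \int[mu]_(x in I01) \int[mu]_(y in I01) g (x, y).
Proof.
move=> ij mg g0; pose phi t : measurableTypeR R * measurableTypeR R := (xi i t, xi j t).
have mxi k : measurable_fun setT (xi k : T -> measurableTypeR R).
  exact: (@measurable_funPT _ _ _ _ (xi k)).
have mphi : measurable_fun setT phi by exact: measurable_fun_pair.
have law A B : measurable A -> measurable B ->
    pushforward P phi (A `*` B) = U A * U B.
  move=> mA mB.
  pose C k := if k == i then A else if k == j then B else setT.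
  have mC k : measurable (C k) by rewrite /C; case: ifP => // _; case: ifP.
  rewrite /pushforward (_ : _ @^-1` _ = [set t | forall k, C k (xi k t)]); last first.
    apply/seteqP; split => [t [At Bt] k|t h] /=.
      by rewrite /C; case: eqP => [->//|_]; case: eqP => [->//|].
    split; first by have := h i; rewrite /C eqxx.
    by have := h j; rewrite /C eqxx eq_sym (negbTE ij).
  rewrite (xi_iid.2 C)// (bigD1 i)//= (bigD1 j) 1?eq_sym//= big1 ?mule1.
    rewrite {1}/C eqxx /C eqxx eq_sym (negbTE ij).
    by congr (_ * _); exact: xi_iid.1.
  move=> k /andP[ki kj]; rewrite /C (negbTE ki) (negbTE kj) preimage_setT.
  exact: probability_setT.
have -> : \int[P]_t g (xi i t, xi j t) = \int[U \x U]_z g z.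
  rewrite -[LHS](@ge0_integral_pushforward _ _ _
    (measurableTypeR R * measurableTypeR R)%type R phi mphi P setT g)//.
  apply: (eq_measure_integral (U \x U)) => A mA _.
  by apply/esym; apply: product_measure_unique mA => //; exact: law.
rewrite fubini_tonelli1// integral_uniform01.
- apply: eq_integral => x _; rewrite /fubini_F integral_uniform01//.
  by apply: measurableT_comp => //; exact: measurable_pair1.
- exact: measurable_fun_fubini_tonelli_F.
- by move=> x; apply: integral_ge0.
Qed.

End UniformSample.

(** * Truncation of the spectral expansion *)

Section OrthonormalExpansions.
Context {R : realType}.
Local Notation mu := (@lebesgue_measure R).
Local Notation I01 := (`[0, 1]%classic : set R).

Lemma in_L2_integrableM (f g : R -> R) : in_L2 f -> in_L2 g ->
  mu.-integrable I01 (fun x => (f x * g x)%:E).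
Proof.
move=> [mf f2] [mg g2].
have sq (h : R -> R) : measurable_fun I01 h ->
    (\int[mu]_(x in I01) (h x ^+ 2)%:E < +oo)%E ->
    mu.-integrable I01 (fun x => (h x ^+ 2)%:E).
  move=> mh h2; apply/integrableP; split.
    by apply/measurable_EFinP; exact: measurable_funX.
  rewrite (eq_integral (fun x : measurableTypeR R => (h x ^+ 2)%:E))// => x _.
  by rewrite gee0_abs// lee_fin sqr_ge0.
have fg2 : mu.-integrable I01 ((fun x => (f x ^+ 2)%:E) \+ (fun x => (g x ^+ 2)%:E))%E.
  by apply: integrableD => //; exact: sq.
apply: le_integrable fg2 => //; first by apply/measurable_EFinP; exact: measurable_funM.
move=> x _ /=; rewrite lee_fin [leRHS]ger0_norm ?addr_ge0 ?sqr_ge0// ler_norml.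
have := sqr_ge0 (f x + g x); have := sqr_ge0 (f x - g x).
have := sqr_ge0 (f x); have := sqr_ge0 (g x) => *.
by apply/andP; split; lra.
Qed.

Variable phi : nat -> R -> R.
Hypothesis phi_L2 : forall i, in_L2 (phi i).
Hypothesis phi_orth : forall i j, inner_L2 (phi i) (phi j) = (i == j)%:R.

Lemma integral_orthonormal i j :
  (\int[mu]_(x in I01) (phi i x * phi j x)%:E = ((i == j)%:R)%:E)%E.
Proof.
have fin := integrable_fin_num _ (in_L2_integrableM (phi_L2 i) (phi_L2 j)).
rewrite -phi_orth /inner_L2 /Rintegral fineK//; exact: fin.
Qed.

Lemma parseval (c : nat -> R) (s : seq nat) : uniq s ->
  (\int[mu]_(x in I01) ((\sum_(k <- s) c k * phi k x) ^+ 2)%:E =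
   (\sum_(k <- s) c k ^+ 2)%:E)%E.
Proof.
move=> us.
have intkl k l : mu.-integrable I01 (fun x => (c k * c l)%:E * (phi k x * phi l x)%:E)%E.
  by apply: integrableZl => //; exact: in_L2_integrableM.
under eq_integral => x _.
  rewrite expr2 big_distrlr /= -sumEFin.
  under eq_bigr => k _.
    rewrite -sumEFin.
    under eq_bigr => l _ do rewrite mulrACA EFinM.
    over.
  over.
rewrite integral_sum//; last by move=> k; exact: integrable_sum.
rewrite -sumEFin; apply: eq_big_seq => k ks; rewrite integral_sum//.
under eq_bigr => l _.
  rewrite integralZl//; last exact: in_L2_integrableM.
  rewrite integral_orthonormal -EFinM.
  over.
rewrite sumEFin (bigD1_seq k)//= eqxx mulr1 big1 ?addr0// => l lk.
by rewrite eq_sym (negbTE lk) mulr0.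
Qed.

Lemma integral_sum_sqr (c : nat -> R) (s : seq nat) : (forall k, 0 <= c k) ->
  (\int[mu]_(x in I01) (\sum_(k <- s) c k * phi k x ^+ 2)%:E =
   (\sum_(k <- s) c k)%:E)%E.
Proof.
move=> c0.
have mphi k : measurable_fun I01 (fun x : measurableTypeR R => (phi k x ^+ 2)%:E).
  by apply/measurable_EFinP; apply: measurable_funX; have [] := phi_L2 k.
under eq_integral => x _.
  rewrite -sumEFin.
  under eq_bigr => k _ do rewrite EFinM.
  over.
rewrite ge0_integral_sum//; last 2 first.
- by move=> k; apply: measurable_funeM; exact: mphi.
- by move=> k x _; apply: mule_ge0; rewrite lee_fin ?c0 ?sqr_ge0.
rewrite -sumEFin; apply: eq_bigr => k _.
rewrite ge0_integralZl//; last 3 first.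
- exact: mphi.
- by move=> x _; rewrite lee_fin sqr_ge0.
- by rewrite lee_fin.
under eq_integral => x _ do rewrite expr2.
by rewrite integral_orthonormal eqxx mule1.
Qed.

Variables (W : R -> R -> R) (omega : nat -> R).
Hypothesis expansion : forall x y, I01 x -> I01 y ->
    (\sum_(i < k) omega i * phi i x * phi i y) @[k --> \oo] --> W x y.

(** The error at (x, y) is the limit of the sums h over r <= k < m.  For fixed x,
    Fatou's lemma and Parseval's identity in y bound the inner integral by the
    limit of sums of omega_k^2 phi_k(x)^2; these increase with m, and
    monotone convergence in x concludes. *)
Lemma truncation_L2_error (r : nat) (tail : R) :
  (forall m, \sum_(r <= k < m) omega k ^+ 2 <= tail) ->
  (\int[mu]_(x in I01) \int[mu]_(y in I01)
     ((W x y - \sum_(k < r) omega k * phi k x * phi k y) ^+ 2)%:E <= tail%:E)%E.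
Proof.
move=> htail.
have mphi k : measurable_fun I01 (phi k) by have [] := phi_L2 k.
pose h m x y : R := \sum_(r <= k < m) omega k * phi k x * phi k y.
pose g m x : \bar R := (\sum_(r <= k < m) omega k ^+ 2 * phi k x ^+ 2)%:E.
have mg m : measurable_fun I01 (g m).
  apply/measurable_EFinP; apply: measurable_sum => k.
  by apply: measurable_funM => //; exact: measurable_funX.
have g0 m x : (0 <= g m x)%E.
  by rewrite lee_fin sumr_ge0// => k _; rewrite mulr_ge0 ?sqr_ge0.
have nd (c : nat -> R) : (forall k, 0 <= c k) ->
    {homo (fun m => (\sum_(r <= k < m) c k)%:E) : a b / (a <= b)%N >-> (a <= b)%E}.
  move=> c0 a b ab; rewrite lee_fin; have [ra|/ltnW ar] := leqP r a.
    by rewrite (big_cat_nat ra ab) /= lerDl sumr_ge0.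
  by rewrite (big_geq ar) sumr_ge0.
have gnd x : {homo g^~ x : a b / (a <= b)%N >-> (a <= b)%E}.
  by apply: nd => k; rewrite mulr_ge0 ?sqr_ge0.
have gcvg x : cvgn (g^~ x) by exact: ereal_nondecreasing_is_cvgn.
have hcvg x y : I01 x -> I01 y ->
    (h m x y ^+ 2)%:E @[m --> \oo] -->
    ((W x y - \sum_(k < r) omega k * phi k x * phi k y) ^+ 2)%:E.
  move=> Ix Iy; apply: cvg_EFin; first by apply: nearW.
  rewrite /comp /=.
  pose S m := \sum_(k < m) omega k * phi k x * phi k y.
  have hS : h m x y @[m --> \oo] --> W x y - S r.
    apply: cvg_trans (cvgB (expansion Ix Iy) (cvg_cst (S r))).
    apply: near_eq_cvg; exists r => // m /= rm.
    transitivity (S m - S r) => //.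
    rewrite /S -!(big_mkord predT (fun k => omega k * phi k x * phi k y)).
    by rewrite [X in X - _](big_cat_nat (leq0n r) rm)/= addrAC subrr add0r.
  by rewrite -/(S r) expr2; under eq_fun do rewrite expr2; exact: cvgM.
have inner x : I01 x -> (\int[mu]_(y in I01)
     ((W x y - \sum_(k < r) omega k * phi k x * phi k y) ^+ 2)%:E <=
     limn (g^~ x))%E.
  move=> Ix.
  have gE m : g m x = (\int[mu]_(y in I01) (h m x y ^+ 2)%:E)%E.
    by rewrite parseval ?iota_uniq//; congr EFin; apply: eq_bigr => k _; rewrite exprMn.
  rewrite -(is_cvg_limn_einfE (gcvg x)) (funext gE).
  rewrite (eq_integral (fun y : measurableTypeR R =>
    limn_einf (fun m => (h m x y ^+ 2)%:E))).
    apply: fatou => //.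
      move=> m; apply/measurable_EFinP; apply: measurable_funX.
      apply: measurable_sum => k.
      by apply: measurable_funM; [exact: measurable_cst|exact: mphi].
    by move=> m y _; rewrite lee_fin sqr_ge0.
  by move=> y; rewrite inE => Iy; rewrite (cvg_limn_einf_sup (hcvg _ _ Ix Iy)).
apply: (@le_trans _ _ (\int[mu]_(x in I01) limn (g^~ x))%E).
  apply: ge0_le_integral_dom => //.
  - by move=> x _; apply: integral_ge0 => y _; rewrite lee_fin sqr_ge0.
  - exact: (emeasurable_fun_cvg g).
rewrite monotone_convergence//.
have -> : (fun m => \int[mu]_(x in I01) g m x)%E =
    (fun m => (\sum_(r <= k < m) omega k ^+ 2)%:E).
  by apply/funext => m; rewrite integral_sum_sqr// => k; exact: sqr_ge0.
apply: lime_le; last by apply: nearW => m; rewrite lee_fin.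
by apply: ereal_nondecreasing_is_cvgn; apply: nd => k; exact: sqr_ge0.
Qed.

End OrthonormalExpansions.

(** * Decay rates *)

Section Decay.
Context {R : realType}.

(** The comparison of a sum with an integral, in discrete form.  With L = ln(k+2)
    one has ln(k+1) <= L - 1/(k+2), and then
    exp(b/(k+2)) >= 1 + b/(k+2) gives the result. *)
Lemma powR_telescope (b : R) (k : nat) : 0 < b ->
  b * k.+2%:R `^ (- (1 + b)) <= k.+1%:R `^ (- b) - k.+2%:R `^ (- b).
Proof.
move=> b0; set L : R := ln k.+2%:R.
have k2 : (0 : R) < k.+2%:R by rewrite ltr0n.
have lnL : ln k.+1%:R <= L - k.+2%:R^-1.
  rewrite -(@ler_expR R) lnK ?posrE ?ltr0n// expRB lnK ?posrE//.
  have h := expR_ge1Dx (- k.+2%:R^-1 : R); rewrite expRN in h.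
  apply: (@le_trans _ _ (k.+2%:R * (1 - k.+2%:R^-1))); last by rewrite ler_pM2l.
  by rewrite mulrBr mulr1 divff ?gt_eqF// -[k.+2%:R]natr1 addrK.
have pE (x : R) (j : nat) : j.+1%:R `^ x = expR (x * ln j.+1%:R).
  by rewrite /powR gt_eqF// ltr0n.
rewrite !pE -/L.
have h1 : expR (- b * L) * (1 + b * k.+2%:R^-1) <= expR (- b * ln k.+1%:R).
  apply: (@le_trans _ _ (expR (- b * L) * expR (b * k.+2%:R^-1))).
    by rewrite ler_pM2l ?expR_gt0// expR_ge1Dx.
  rewrite -expRD ler_expR !mulNr lerNr opprD opprK -mulrN -mulrDr.
  by rewrite ler_pM2l.
have -> : expR (- (1 + b) * L) = expR (- b * L) * k.+2%:R^-1.
  have -> : - (1 + b) * L = - b * L - L by ring.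
  by rewrite expRB lnK.
move: h1; set e := expR _; set e' := expR _; set v := _^-1 => h1; nra.
Qed.

Lemma decay_tail (alpha C : R) (omega : nat -> R) (r m : nat) :
  2^-1 < alpha -> (forall k, `|omega k| <= C * (k.+1%:R : R) `^ (- alpha)) ->
  \sum_(r.+1 <= k < m) omega k ^+ 2 <=
  C ^+ 2 / (2 * alpha - 1) * r.+1%:R `^ (- (2 * alpha - 1)).
Proof.
move=> a2 dec; set b := 2 * alpha - 1.
have b0 : 0 < b by rewrite /b; lra.
have C2b : 0 <= C ^+ 2 / b by rewrite divr_ge0 ?sqr_ge0// ltW.
have [mr|rm] := leqP m r.+1.
  by rewrite big_geq// mulr_ge0// powR_ge0.
suff : \sum_(r.+1 <= k < m) omega k ^+ 2 <=
    C ^+ 2 / b * (r.+1%:R `^ (- b) - m%:R `^ (- b)).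
  by move=> /le_trans; apply; rewrite ler_wpM2l// gerBl powR_ge0.
elim: m {rm}(ltnW rm) => // m IH; rewrite leq_eqVlt => /predU1P[<-|rm].
  by rewrite big_geq// subrr mulr0.
rewrite ltnS in rm; rewrite big_nat_recr//=.
have {IH} := IH rm; case: m rm => // m rm IH.
have w2 : omega m.+1 ^+ 2 <= C ^+ 2 * m.+2%:R `^ (- (1 + b)).
  rewrite -real_normK ?num_real//.
  apply: (@le_trans _ _ ((C * m.+2%:R `^ (- alpha)) ^+ 2)).
    by rewrite lerXn2r ?nnegrE// (le_trans _ (dec _)).
  rewrite exprMn -[X in _ * X <= _]powR_mulrn ?powR_ge0// -powRrM.
  by rewrite (_ : - alpha * 2%:R = - (1 + b))// /b; ring.
have : C ^+ 2 / b * (b * m.+2%:R `^ (- (1 + b))) <=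
    C ^+ 2 / b * (m.+1%:R `^ (- b) - m.+2%:R `^ (- b)).
  by rewrite ler_wpM2l// powR_telescope.
rewrite mulrA divfK ?gt_eqF// => h.
have -> : r.+1%:R `^ (- b) - m.+2%:R `^ (- b) =
  (r.+1%:R `^ (- b) - m.+1%:R `^ (- b)) + (m.+1%:R `^ (- b) - m.+2%:R `^ (- b)) by ring.
rewrite mulrDr; apply: lerD => //; exact: le_trans h.
Qed.

(** Bernoulli's inequality for 10/9. *)
Lemma geometric_le_inv (n : nat) : (0 < n)%N -> (9 / 10 : R) ^+ n <= 9 / n%:R.
Proof.
move=> n0.
have bern k : 1 + k%:R / 9 <= (10 / 9 : R) ^+ k.
  elim: k => [|k IH]; first by rewrite mul0r addr0 expr0.
  have k0 : 0 <= k%:R :> R by rewrite ler0n.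
  by rewrite exprS -natr1; lra.
have -> : 9 / 10 = (10 / 9)^-1 :> R by rewrite invf_div.
have pos : 0 < (10 / 9 : R) ^+ n by rewrite exprn_gt0// divr_gt0.
rewrite exprVn -[9 / n%:R]invf_div lef_pV2 ?posrE ?divr_gt0 ?ltr0n//.
apply: le_trans (bern n); lra.
Qed.

End Decay.

(** * From thresholding to the estimator *)

Section USVT.
Context {R : realType} {n : nat}.
Implicit Types A M Mhat : 'M[R]_n.

Lemma frobenius_normK (A : 'M[R]_n) : frobenius_norm A ^+ 2 = sqfro A.
Proof. by rewrite sqr_sqrtr// sqfro_ge0. Qed.

Lemma clip01_contract (x m : R) : 0 <= m <= 1 ->
  (clip01 x - m) ^+ 2 <= (x - m) ^+ 2.
Proof.
move=> /andP[m0 m1]; rewrite /clip01.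
have [x0|x0] := leP x 0; first by rewrite minElt ltr10; nra.
have [x1|x1] := leP 1 x; nra.
Qed.

Lemma clip01_itv (x : R) : 0 <= clip01 x <= 1.
Proof. by rewrite /clip01 le_min ler01 le_max lexx /= ge_min lexx. Qed.

Lemma usvt_error_trivial tau A M Mhat : is_usvt tau A Mhat ->
  (forall i j, 0 <= M i j <= 1) -> (forall i, M i i = 0) ->
  frobenius_norm (Mhat - M) ^+ 2 <= n%:R ^+ 2.
Proof.
move=> [U [s [V [_ ->]]]] M01 M0; rewrite frobenius_normK.
apply: (@le_trans _ _ (\sum_(i < n) \sum_(j < n) 1)); last first.
  by rewrite !sumr_const card_ord -mulr_natl mulr1 expr2 mulr_natl.
apply: ler_sum => i _; apply: ler_sum => j _; rewrite !mxE.
case: eqP => [->|_]; first by rewrite M0 subr0 expr0n.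
set c := clip01 _; have /andP[c0 c1] : 0 <= c <= 1 by exact: clip01_itv.
have /andP[m0 m1] := M01 i j.
by move: (M i j) m0 m1 c c0 c1 => u m0 m1 v *; nra.
Qed.

Lemma usvt_error tau A M Mhat r (F : 'M[R]_(n, r)) (G : 'M[R]_(r, n)) (k : R) :
  is_usvt tau A Mhat -> 0 < tau ->
  (forall i j, 0 <= M i j <= 1) -> (forall i, M i i = 0) ->
  (A - M)^T = A - M -> 0 < k -> k <= 15 / 16 * tau ->
  (forall y, `|mxform (A - M) y y| <= k * sqfro y) ->
  frobenius_norm (Mhat - M) ^+ 2 <=
  72 * tau ^+ 2 * r%:R + 4097 * sqfro (M - F *m G).
Proof.
move=> [U [s [V [[[U1 V1] s0 _ AE] ->]]]] tau0 M01 M0 XT k0 ktau normX.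
apply: le_trans (truncation_error U1 V1 s0 AE tau0 F G XT k0 ktau normX).
rewrite frobenius_normK; apply: ler_sum => i _; apply: ler_sum => j _.
rewrite !mxE; case: eqP => [->|_]; first by rewrite M0 subr0 expr0n sqr_ge0.
exact: clip01_contract.
Qed.

End USVT.

(** * Probability of a large noise *)

Section Patch.
Context {R : realType}.
Local Notation I01 := (`[0, 1]%classic : set R).

Definition square01 : set (R * R) := I01 `*` I01.

Lemma measurable_square01 : measurable square01.
Proof. exact: measurableX. Qed.

Variable W : R -> R -> R.
Hypothesis gW : graphon W.

(** A graphon is measurable, with values in [0,1], on the unit square only; its
    extension by 0 is so on the plane. *)
Definition graphon_patch : R * R -> R := (fun p => W p.1 p.2) \_ square01.

Lemma graphon_patchE x y : I01 x -> I01 y -> graphon_patch (x, y) = W x y.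
Proof. by move=> Ix Iy; rewrite /graphon_patch patchE mem_set. Qed.

Lemma measurable_graphon_patch : measurable_fun setT graphon_patch.
Proof.
case: gW => mW _ _; apply/(measurable_restrictT _ _).1 => //.
exact: measurable_square01.
Qed.

Lemma graphon_patch_01 p : 0 <= graphon_patch p <= 1.
Proof.
case: gW => _ _ W01; rewrite /graphon_patch patchE; case: ifPn => [|_].
  by rewrite inE => -[I1 I2]; exact: W01.
by rewrite lexx ler01.
Qed.

End Patch.

Lemma measurable_large_noise (R : realType) d (T : measurableType d) n
    (q : T -> 'I_n * 'I_n -> R) f :
  (forall ij, measurable_fun setT (q^~ ij)) ->
  measurable [set t | large_noise (q t) f].
Proof.
move=> mq; pose c : R := 64 * (15 / 4 * Num.sqrt n%:R) * n%:R.
rewrite (_ : [set _ | _] = \bigcup_(g in [set g | g \in lattice_ball])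
   [set t | c < `|lattice_noise (q t) g f|]); last first.
  apply/seteqP; split => [t /existsP[g /andP[gL tg]]|t [g gL tg]].
    by exists g.
  by apply/existsP; exists g; apply/andP.
apply: fin_bigcup_measurable => // g _.
have mn : measurable_fun setT (fun t => `|lattice_noise (q t) g f|).
  apply: measurableT_comp => //.
  rewrite /lattice_noise; under eq_fun do rewrite big_mkcond.
  apply: measurable_sum => ij; case: (upper ij) => //.
  by apply: measurable_funM => //; exact: measurable_funB.
have := mn measurableT `]c, +oo[%classic; rewrite setTI.
rewrite (_ : _ @^-1` _ = [set t | c < `|lattice_noise (q t) g f|]).
  by apply.
by apply/seteqP; split => t /=; rewrite in_itv/= andbT.
Qed.

Section LargeNoise.
Context {R : realType} {d : measure_display} {T : measurableType d}.
Variables (P : probability T R) (n : nat) (xi : 'I_n -> {RV P >-> R}).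
Variables (W : R -> R -> R) (A : T -> 'M[bool]_n).
Hypothesis gW : graphon W.
Hypothesis A_law :
  adjacency_given xi (fun t => prob_matrix W (fun i => xi i t)) A.
Local Notation I01 := (`[0, 1]%classic : set R).

Definition in_itv01 : set T := [set t | forall i, I01 (xi i t)].

Definition edge_prob t (ij : 'I_n * 'I_n) : R :=
  graphon_patch W (xi ij.1 t, xi ij.2 t).

Let p01 t ij : 0 <= edge_prob t ij <= 1.
Proof. exact: graphon_patch_01. Qed.

Definition graph_event (f : {ffun 'I_n * 'I_n -> bool}) : set T :=
  [set t | forall i j : 'I_n, (i < j)%N -> A t i j = f (i, j)].

(** This event depends on [xi] only, so that the conditional law of the graph
    applies to it. *)
Definition latent_event (f : {ffun 'I_n * 'I_n -> bool}) : set T :=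
  in_itv01 `&` [set t | f \in outcomes upper /\ large_noise (edge_prob t) f].

(** T with the sigma-algebra generated by [xi], to which the events conditioned
    upon must belong. *)
Let T' : measurableType _ := g_sigma_algebraType
  (\big[setU/set0]_(i < n) preimage_set_system setT (xi i : T -> R) measurable).

Let generator i (Y : set R) : measurable Y ->
  (\big[setU/set0]_(i < n) preimage_set_system setT (xi i : T -> R) measurable)
    (setT `&` xi i @^-1` Y).
Proof. by move=> mY; rewrite (bigD1 i)//=; left; exists Y. Qed.

Let mxi' i : measurable_fun (setT : set T') (xi i : T' -> R).
Proof. by move=> _ Y mY; apply: sub_sigma_algebra; exact: generator. Qed.

Let sub_measurable (E : set T) : measurable (E : set T') -> measurable E.
Proof.
move: E; apply: smallest_sub; first exact: sigma_algebra_measurable.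
elim/big_ind: _ => [//|B C hB hC E [/hB|/hC]//|i _ E [Y mY <-]].
exact: measurable_funPT.
Qed.

Let measurable_edge_prob' ij :
  measurable_fun (setT : set T') (fun t => edge_prob t ij).
Proof.
apply: (measurableT_comp (measurable_graphon_patch gW)).
exact: measurable_fun_pair.
Qed.

Lemma measurable_edge_prob ij : measurable_fun setT (edge_prob^~ ij).
Proof.
move=> _ Y mY; apply: sub_measurable.
exact: measurable_edge_prob'.
Qed.

Let measurable_in_itv' : measurable (in_itv01 : set T').
Proof.
rewrite (_ : in_itv01 = \bigcap_(i in [set: 'I_n]) (xi i @^-1` I01)).
  apply: fin_bigcap_measurable => // i _.
  by rewrite -[_ @^-1` _]setTI; exact: mxi'.
by apply/seteqP; split => [t h i _|t h i]; exact: h.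
Qed.

Lemma measurable_in_itv : measurable in_itv01.
Proof. exact: sub_measurable. Qed.

Let measurable_latent_event' f : measurable (latent_event f : set T').
Proof.
apply: measurableI => //.
have [fo|fo] := boolP (f \in outcomes upper); last first.
  rewrite (_ : [set _ | _] = set0)//.
  by apply/seteqP; split => // t [h].
rewrite (_ : [set _ | _] = [set t | large_noise (edge_prob t) f]).
  exact: measurable_large_noise.
by apply/seteqP; split => [t []|t].
Qed.

Lemma measurable_latent_event f : measurable (latent_event f).
Proof. exact: sub_measurable. Qed.

Lemma measurable_graph_event f : measurable (graph_event f).
Proof.
case: A_law => mA _ _ _.
rewrite (_ : graph_event f = \bigcap_(ij in [set ij | upper ij])
    ((fun t => A t ij.1 ij.2) @^-1` [set f ij])).
  apply: fin_bigcap_measurable => // ij _.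
  by rewrite -[_ @^-1` _]setTI; exact: mA.
apply/seteqP; split => [t h [i j] /= ij|t h i j ij]; first exact: h.
exact: (h (i, j)).
Qed.

Local Open Scope ereal_scope.

(** The conditional law of the graph, applied to a single graph. *)
Lemma latent_graph_law f :
  P (latent_event f `&` graph_event f) =
  \int[P]_(t in latent_event f) (bernoulli_weight upper (edge_prob t) f)%:E.
Proof.
case: A_law => _ _ _ /(_ (latent_event f) (fun i j => [set f (i, j)])).
move=> /(_ (measurable_latent_event' f)) ->.
apply: eq_integral => t; rewrite inE => -[tI _].
rewrite /bernoulli_weight (big_morph EFin EFinM erefl).
apply: eq_bigr => -[i j] /= ij.
have -> : prob_matrix W (fun i => xi i t) i j = edge_prob t (i, j).
  rewrite mxE /edge_prob graphon_patchE// (_ : i != j) ?mulr1//.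
  by apply: contraTneq ij => ->; rewrite ltnn.
rewrite bernoulli_probE//= !diracE.
have memE (b c : bool) : (b \in [set c]) = (b == c).
  by apply/idP/eqP => [|->]; rewrite inE.
by case: (f (i, j)); rewrite !memE /= ?mule1 ?mule0 ?adde0 ?add0e.
Qed.

(** Summing over the graphs under the integral leaves, for each value of [xi], the
    weight of the large noises for a fixed probability matrix. *)
Lemma large_noise_probability :
  \sum_f P (latent_event f `&` graph_event f) <= (2 * (9 / 10) ^+ n)%:E.
Proof.
under eq_bigr => f _ do rewrite latent_graph_law integral_mkcond.
have mw f : measurable_fun setT
    ((fun t => (bernoulli_weight upper (edge_prob t) f)%:E) \_ (latent_event f)).
  apply/(measurable_restrictT _ _).1; first exact: measurable_latent_event.
  apply: measurable_funTS; apply/measurable_EFinP.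
  rewrite /bernoulli_weight; under eq_fun do rewrite big_mkcond.
  apply: measurable_prod => ij _; case: (upper ij) => //.
  case: (f ij) => /=; first exact: measurable_edge_prob.
  by apply: measurable_funB => //; exact: measurable_edge_prob.
have w0 f t : 0 <=
    ((fun t => (bernoulli_weight upper (edge_prob t) f)%:E) \_ (latent_event f)) t.
  by apply: erestrict_ge0 => s _; rewrite lee_fin bernoulli_weight_ge0.
rewrite -ge0_integral_sum//.
apply: (@le_trans _ _ (\int[P]_t (2 * (9 / 10) ^+ n)%:E)); last first.
  by rewrite integral_cst// [X in (_ * X)%E](probability_setT P) mule1.
apply: ge0_le_integral_dom => // [t _|t _]; first exact: sume_ge0.
apply: (@le_trans _ _ (\sum_(f in outcomes upper | large_noise (edge_prob t) f)
    bernoulli_weight upper (edge_prob t) f)%R%:E); last first.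
  by rewrite lee_fin; exact: large_noise_weight.
rewrite [X in (_ <= X%:E)%E]big_mkcond -sumEFin; apply: lee_sum => f _.
rewrite patchE; case: ifPn => [|_].
  by rewrite inE => -[_ [-> ->]].
by case: ifP => _; rewrite lee_fin ?bernoulli_weight_ge0.
Qed.

End LargeNoise.

(** * The rank of the approximation *)

(** With p = n^(1 / (2 alpha)) >= 1 and rho = p / n, one has
    p^(1 - 2 alpha) = rho, and the rank r0 + floor p + 1 lies between p and
    (r0 + 2) p. *)
Lemma truncation_rank (R : realType) (alpha : R) (r0 n : nat) :
  2^-1 < alpha -> (0 < n)%N ->
  let rho := n%:R `^ (- ((2 * alpha - 1) / (2 * alpha))) : R in
  exists r : nat, [/\ (r0 <= r)%N,
    r.+1%:R / n%:R <= (r0.+2)%:R * rho,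
    (r.+1%:R : R) `^ (- (2 * alpha - 1)) <= rho &
    n%:R^-1 <= rho].
Proof.
move=> a2 n0 rho.
have N0 : (0 : R) < n%:R by rewrite ltr0n.
have N1 : (1 : R) <= n%:R by rewrite ler1n.
have a0 : 0 < 2 * alpha by lra.
pose p : R := n%:R `^ (2 * alpha)^-1.
have p1 : 1 <= p.
  have <- : 1 `^ (2 * alpha)^-1 = 1 :> R by rewrite powR1.
  by apply: ge0_ler_powR; rewrite ?nnegrE ?invr_ge0 ?ler01 ?(ltW a0) ?(ltW N0).
have p0 : 0 < p by exact: lt_le_trans p1.
have pN : p / n%:R = rho.
  rewrite /p /rho -[X in _ / X](powRr1 (ltW N0)) -powRN -powRD; last first.
    by apply/implyP => _; rewrite gt_eqF.
  by congr (_ `^ _); field; lra.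
have pb : p `^ (- (2 * alpha - 1)) = rho.
  by rewrite /p -powRrM; congr (_ `^ _); field; lra.
exists (r0 + Num.truncn p)%N; split.
- exact: leq_addr.
- rewrite -pN mulrA ler_pM2r ?invr_gt0// -addnS natrD -natr1.
  have := truncn_le p; rewrite (ltW p0) => tp.
  have r00 : 0 <= r0%:R * (p - 1) by rewrite mulr_ge0// subr_ge0.
  by rewrite -[r0.+2%:R]natr1 -[r0.+1%:R]natr1; lra.
- rewrite -pb !powRN lef_pV2 ?posrE ?powR_gt0 ?ltr0n//.
  apply: ge0_ler_powR; rewrite ?nnegrE ?ler0n ?(ltW p0)//; first by lra.
  apply: le_trans (ltW (truncnS_gt p)) _.
  by rewrite ler_nat ltnS leq_addl.
- by rewrite -pN ler_peMl ?invr_ge0// ltW.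
Qed.

Section DiagonalBound.
Context {R : realType}.
Variables (W : R -> R -> R) (omega : nat -> R) (phi : nat -> R -> R).
Hypothesis gW : graphon W.
Hypothesis phi_L2 : forall i, in_L2 (phi i).
Local Notation mu := (@lebesgue_measure R).
Local Notation I01 := (`[0, 1]%classic : set R).

Lemma measurable_graphon_diag : measurable_fun I01 (fun x => W x x).
Proof.
apply: (eq_measurable_fun (fun x => graphon_patch W (x, x))).
  by move=> x; rewrite inE => Ix; rewrite graphon_patchE.
apply: measurable_funTS; apply: (measurableT_comp (measurable_graphon_patch gW)).
by apply: measurable_fun_pair; exact: measurable_id.
Qed.

(** Eventually the diagonal partial sums are at distance at most 1 from W(x, x) in
    L2, and W is at most 1; hence 2 + 2.  For small r the functions phi_k^2 may
    fail to be square integrable. *)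
Lemma diagonal_L2_bounded : diagonal_cvg_L2 W omega phi ->
  exists r0, forall r, (r0 <= r)%N ->
    (\int[mu]_(x in I01) ((\sum_(i < r) omega i * phi i x ^+ 2) ^+ 2)%:E <= 4%:E)%E.
Proof.
move=> /fine_cvgP[fin cv].
have le1 : \forall k \near \oo, (\int[mu]_(x in I01)
     ((\sum_(i < k) omega i * phi i x ^+ 2 - W x x) ^+ 2)%:E <= 1)%E.
  have cv1 := cvgr_le _ cv 1 ltr01.
  near=> k; rewrite -[leLHS]fineK ?lee_fin.
    by near: k; exact: cv1.
  by near: k; exact: fin.
case: le1 => r0 _ le1; exists r0 => r /le1 le_r.
have msum : measurable_fun I01
    (fun x : measurableTypeR R => \sum_(i < r) omega i * phi i x ^+ 2).
  apply: measurable_sum => i; apply: measurable_funM => //.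
  by apply: measurable_funX; have [] := phi_L2 i.
have mdiff : measurable_fun I01 (fun x : measurableTypeR R =>
    ((\sum_(i < r) omega i * phi i x ^+ 2 - W x x) ^+ 2)%:E).
  apply/measurable_EFinP; apply: measurable_funX; apply: measurable_funB => //.
  exact: measurable_graphon_diag.
apply: (@le_trans _ _ (\int[mu]_(x in I01) (2%:E *
    ((\sum_(i < r) omega i * phi i x ^+ 2 - W x x) ^+ 2)%:E + 2%:E))%E).
  apply: ge0_le_integral_dom => //.
  - by move=> x _; rewrite lee_fin sqr_ge0.
  - by apply: emeasurable_funD => //; exact: measurable_funeM.
  - move=> x Ix; rewrite -EFinM -EFinD lee_fin.
    case: gW => _ _ /(_ x x Ix Ix)/andP[w0 w1].
    set a := \sum_(_ < _) _; set w := W x x in w0 w1 *.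
    by have := sqr_ge0 (a - 2 * w); nra.
rewrite ge0_integralD//; last 2 first.
- by move=> x _; rewrite mule_ge0// lee_fin sqr_ge0.
- exact: measurable_funeM.
rewrite ge0_integralZl//; last by move=> x _; rewrite lee_fin sqr_ge0.
rewrite integral_cst//= lebesgue_measure_itv/= lte_fin ltr01 sube0 mule1.
have -> : (4%:E = 2%:E * 1 + 2%:E :> \bar R)%E.
  by rewrite mule1 -EFinD; congr EFin; lra.
by rewrite leeD2r// lee_wpmul2l.
Unshelve. all: by end_near. Qed.

End DiagonalBound.

(** * The risk of the estimator *)

Section Risk.
Context {R : realType}.
Variables (W : R -> R -> R) (omega : nat -> R) (phi : nat -> R -> R).
Hypothesis gW : graphon W.
Hypothesis phi_L2 : forall i, in_L2 (phi i).
Local Notation mu := (@lebesgue_measure R).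
Local Notation I01 := (`[0, 1]%classic : set R).

(** As for the graphon, the extension by 0 is measurable on the line. *)
Definition phi_patch k : R -> R := phi k \_ I01.

Let phi_patchE k x : I01 x -> phi_patch k x = phi k x.
Proof. by move=> Ix; rewrite /phi_patch patchE mem_set. Qed.

Let measurable_phi_patch k : measurable_fun setT (phi_patch k).
Proof. by apply/(measurable_restrictT _ _).1 => //; have [] := phi_L2 k. Qed.

Variable r : nat.

Definition offdiag_error (p : R * R) : R :=
  (graphon_patch W p - \sum_(k < r) omega k * phi_patch k p.1 * phi_patch k p.2) ^+ 2.

Definition diag_error (x : R) : R :=
  (\sum_(k < r) omega k * phi_patch k x ^+ 2) ^+ 2.

Lemma measurable_offdiag_error : measurable_fun setT offdiag_error.
Proof.
apply: measurable_funX; apply: measurable_funB; first exact: measurable_graphon_patch.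
apply: measurable_sum => k; apply: measurable_funM.
  apply: measurable_funM => //.
  by apply: (measurableT_comp (measurable_phi_patch k)); exact: measurable_fst.
by apply: (measurableT_comp (measurable_phi_patch k)); exact: measurable_snd.
Qed.

Lemma measurable_diag_error : measurable_fun setT diag_error.
Proof.
apply: measurable_funX; apply: measurable_sum => k; apply: measurable_funM => //.
exact: measurable_funX.
Qed.

Context {d : measure_display} {T : measurableType d}.
Variables (P : probability T R) (n : nat) (xi : 'I_n -> {RV P >-> R}).

(** The squared entries of M - B_r: on the diagonal M is zero. *)
Definition entry_error (i j : 'I_n) (t : T) : R :=
  if i == j then diag_error (xi i t) else offdiag_error (xi i t, xi j t).

Lemma entry_error_ge0 i j t : 0 <= entry_error i j t.
Proof. by rewrite /entry_error; case: eqP => _; exact: sqr_ge0. Qed.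

Lemma measurable_entry_error i j : measurable_fun setT (entry_error i j).
Proof.
rewrite /entry_error; case: eqP => _.
  by apply: (measurableT_comp measurable_diag_error).
apply: (measurableT_comp measurable_offdiag_error).
exact: measurable_fun_pair.
Qed.

Lemma expected_truncation_error (tail : R) : iid_uniform01 xi ->
  0 <= tail ->
  (\int[mu]_(x in I01) \int[mu]_(y in I01)
     ((W x y - \sum_(k < r) omega k * phi k x * phi k y) ^+ 2)%:E <= tail%:E)%E ->
  (\int[mu]_(x in I01) ((\sum_(k < r) omega k * phi k x ^+ 2) ^+ 2)%:E <= 4%:E)%E ->
  (\sum_i \sum_j \int[P]_t (entry_error i j t)%:E <=
    (n%:R ^+ 2 * tail + 4 * n%:R)%:E)%E.
Proof.
move=> iid tail0 htail hdiag.
have off i j : i != j -> (\int[P]_t (entry_error i j t)%:E <= tail%:E)%E.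
  move=> ij; rewrite /entry_error (negbTE ij).
  have m2 : measurable_fun setT (EFin \o offdiag_error).
    by apply/measurable_EFinP; exact: measurable_offdiag_error.
  have p2 x : (0 <= (EFin \o offdiag_error) x)%E by rewrite lee_fin sqr_ge0.
  rewrite (expectation_two iid ij m2 p2).
  apply: le_trans htail; rewrite le_eqVlt; apply/orP; left; apply/eqP.
  apply: eq_integral => x; rewrite inE => Ix.
  apply: eq_integral => y; rewrite inE => Iy.
  rewrite /= /offdiag_error graphon_patchE//; congr ((_ - _) ^+ 2)%:E.
  by apply: eq_bigr => k _; rewrite !phi_patchE.
have dia i : (\int[P]_t (entry_error i i t)%:E <= 4%:E)%E.
  rewrite /entry_error eqxx (expectation_one iid i (g := EFin \o diag_error)); last 2 first.
  - by apply/measurable_EFinP; exact: measurable_diag_error.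
  - by move=> x; rewrite lee_fin sqr_ge0.
  apply: le_trans hdiag; rewrite le_eqVlt; apply/orP; left; apply/eqP.
  apply: eq_integral => x; rewrite inE => Ix.
  rewrite /= /diag_error; congr (_ ^+ 2)%:E.
  by apply: eq_bigr => k _; rewrite phi_patchE.
have -> : n%:R ^+ 2 * tail + 4 * n%:R =
    \sum_(i < n) \sum_(j < n) (tail + 4 * (j == i)%:R).
  under [RHS]eq_bigr => i _.
    rewrite big_split /= sumr_const card_ord -mulr_sumr (bigD1 i)//= eqxx.
    rewrite big1 ?addr0 ?mulr1; last by move=> j /negbTE ->.
    over.
  by rewrite sumr_const card_ord -[RHS]mulr_natl -[tail *+ n]mulr_natl; ring.
rewrite -sumEFin; apply: lee_sum => i _; rewrite -sumEFin; apply: lee_sum => j _.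
have [->|ji] := eqVneq j i.
  by apply: le_trans (dia i) _; rewrite lee_fin /= mulr1 lerDr.
by rewrite mulr0 addr0 off// eq_sym.
Qed.

Variable (A : T -> 'M[bool]_n).
Let M t := prob_matrix W (fun i => xi i t).

Lemma prob_matrix_sym t : in_itv01 xi t -> (M t)^T = M t.
Proof.
move=> It; have Ix i : I01 (xi i t) := It i.
apply/matrixP => i j; rewrite !mxE eq_sym.
by case: gW => _ WC _; rewrite WC.
Qed.

Lemma prob_matrix_itv t i j : in_itv01 xi t -> 0 <= M t i j <= 1.
Proof.
move=> It; have Ix k : I01 (xi k t) := It k.
case: gW => _ _ W01; rewrite mxE.
case: (i != j); first by rewrite mulr1 W01.
by rewrite mulr0 lexx ler01.
Qed.

Lemma prob_matrix_truncation t : in_itv01 xi t ->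
  sqfro (M t - (\matrix_(i < n, k < r) (omega k * phi k (xi i t))) *m
               (\matrix_(k < r, j < n) phi k (xi j t))) =
  \sum_i \sum_j entry_error i j t.
Proof.
move=> It; have Ix i : I01 (xi i t) := It i.
apply: eq_bigr => i _; apply: eq_bigr => j _; rewrite !mxE.
rewrite /entry_error; case: eqVneq => [<-|ij]; last first.
  rewrite mulr1 /offdiag_error graphon_patchE//; congr ((_ - _) ^+ 2).
  by apply: eq_bigr => k _; rewrite !mxE /= !phi_patchE.
rewrite mulr0 sub0r sqrrN; congr (_ ^+ 2).
by apply: eq_bigr => k _; rewrite !mxE phi_patchE// expr2 mulrA.
Qed.

(** The sum of indicators is 1 when the noise is large and 0 otherwise: among the
    graphs [f], only the actual one contributes. *)
Lemma pointwise_risk (tau : R) (Mhat : 'M[R]_n) t : (0 < n)%N ->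
  adjacency_given xi M A -> 4 * Num.sqrt n%:R <= tau ->
  is_usvt tau (real_mx (A t)) Mhat -> in_itv01 xi t ->
  frobenius_norm (Mhat - M t) ^+ 2 <=
  n%:R ^+ 2 * (\sum_f \1_(latent_event xi W f `&` graph_event A f) t) +
  (72 * tau ^+ 2 * r%:R + 4097 * (\sum_i \sum_j entry_error i j t)).
Proof.
move=> n0 [_ AT A0 _] tau4 usvt It; have Ix i : I01 (xi i t) := It i.
have s0 : 0 < Num.sqrt n%:R :> R by rewrite sqrtr_gt0 ltr0n.
have tau0 : 0 < tau by apply: lt_le_trans tau4; rewrite mulr_gt0.
have M01 i j := prob_matrix_itv i j It.
have M0 i : M t i i = 0 by rewrite mxE eqxx mulr0.
have err0 : 0 <= \sum_i \sum_j entry_error i j t.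
  by apply: sumr_ge0 => i _; apply: sumr_ge0 => j _; exact: entry_error_ge0.
have err1 : 0 <= 4097 * (\sum_i \sum_j entry_error i j t).
  by apply: mulr_ge0; [exact: ler0n|exact: err0].
have rank0 : 0 <= 72 * tau ^+ 2 * r%:R.
  by apply: mulr_ge0; [apply: mulr_ge0; [exact: ler0n|exact: sqr_ge0]|exact: ler0n].
have ind0 f : 0 <= \1_(latent_event xi W f `&` graph_event A f) t :> R.
  by rewrite indicE ler0n.
pose f : {ffun 'I_n * 'I_n -> bool} := [ffun ij => upper ij && A t ij.1 ij.2].
have fo : f \in outcomes upper.
  apply/pfamilyP; split => //; apply/fintype.subsetP => ij.
  by rewrite !unfold_in ffunE /upper; case: (_ < _)%N.
have gf : graph_event A f t by move=> i j ij; rewrite ffunE /upper /= ij.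
have [big|small] := boolP (large_noise (edge_prob xi W t) f).
  apply: (@le_trans _ _ (n%:R ^+ 2)); first exact: (usvt_error_trivial usvt).
  apply: (@le_trans _ _ (n%:R ^+ 2 * 1 + 0)); first by rewrite mulr1 addr0.
  apply: lerD; last exact: addr_ge0.
  rewrite ler_wpM2l ?sqr_ge0// (bigD1 f)//= indicE mem_set /=; last by split.
  by rewrite lerDl sumr_ge0.
rewrite -[leLHS]add0r; apply: lerD; first by rewrite mulr_ge0 ?sqr_ge0// sumr_ge0.
rewrite -prob_matrix_truncation//.
have XT : (real_mx (A t) - M t)^T = real_mx (A t) - M t.
  rewrite linearB /= prob_matrix_sym//; congr (_ - _).
  by apply/matrixP => i j; rewrite !mxE -[in LHS](AT t) mxE.
apply: (usvt_error _ _ usvt tau0 M01 M0 XT (k := 15 / 4 * Num.sqrt n%:R)).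
- by rewrite mulr_gt0// divr_gt0.
- by lra.
- apply: (small_noise_norm XT _ _ small) => [i|[i j] ij].
    by rewrite mxE [X in _ + X]mxE M0 subr0 mxE A0.
  rewrite /f ffunE ij /= !mxE /edge_prob graphon_patchE//.
  rewrite (_ : i != j) ?mulr1//.
  by apply: contraTneq ij => ->; rewrite /upper ltnn.
Qed.

Lemma expected_risk (tau tail : R) (Mhat : T -> 'M[R]_n) : (0 < n)%N ->
  iid_uniform01 xi -> adjacency_given xi M A -> 4 * Num.sqrt n%:R <= tau ->
  (forall t, is_usvt tau (real_mx (A t)) (Mhat t)) ->
  0 <= tail ->
  (\int[mu]_(x in I01) \int[mu]_(y in I01)
     ((W x y - \sum_(k < r) omega k * phi k x * phi k y) ^+ 2)%:E <= tail%:E)%E ->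
  (\int[mu]_(x in I01) ((\sum_(k < r) omega k * phi k x ^+ 2) ^+ 2)%:E <= 4%:E)%E ->
  ('E_P[fun t => (frobenius_norm (Mhat t - M t) ^+ 2)%R] <=
    (n%:R ^+ 2 * (2 * (9 / 10) ^+ n) +
    (72 * tau ^+ 2 * r%:R + 4097 * (n%:R ^+ 2 * tail + 4 * n%:R)))%:E)%E.
Proof.
move=> n0 iid Alaw tau4 usvt tail0 htail hdiag.
pose ev f : set T := latent_event xi W f `&` graph_event A f.
have mev f : measurable (ev f).
  apply: measurableI; [exact: measurable_latent_event|exact: measurable_graph_event Alaw f].
pose a t : R := n%:R ^+ 2 * (\sum_f \1_(ev f) t).
pose c t : R := 4097 * (\sum_i \sum_j entry_error i j t).
pose b : R := 72 * tau ^+ 2 * r%:R.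
have b0 : 0 <= b.
  by apply: mulr_ge0; [apply: mulr_ge0; [exact: ler0n|exact: sqr_ge0]|exact: ler0n].
have ind0 f t : 0 <= \1_(ev f) t :> R by rewrite indicE ler0n.
have a0 t : 0 <= a t by rewrite mulr_ge0 ?sqr_ge0// sumr_ge0.
have c0 t : 0 <= c t.
  apply: mulr_ge0; [exact: ler0n|apply: sumr_ge0 => i _; apply: sumr_ge0 => j _].
  exact: entry_error_ge0.
have ma : measurable_fun setT a.
  by apply: measurable_funM => //; apply: measurable_sum => f; exact: measurable_indic.
have mc : measurable_fun setT c.
  apply: measurable_funM => //; apply: measurable_sum => i; apply: measurable_sum => j.
  exact: measurable_entry_error.
rewrite unlock.
apply: (@le_trans _ _ (\int[P]_t ((a t)%:E + (b%:E + (c t)%:E)))%E).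
  apply: ge0_le_integral_ae.
  - by move=> t; rewrite lee_fin sqr_ge0.
  - by move=> t; rewrite -!EFinD lee_fin !addr_ge0.
  - by apply/measurable_EFinP; apply: measurable_funD => //; exact: measurable_funD.
  - exists (~` in_itv01 xi); split.
    + by apply: measurableC; exact: measurable_in_itv.
    + transitivity (1 - P (in_itv01 xi))%E.
        by apply: probability_setC; exact: measurable_in_itv.
      by rewrite [X in (_ - X)%E](sample_in_itv iid) subee.
    + apply: subsetC => t It /=; rewrite -!EFinD lee_fin.
      exact: (pointwise_risk n0 Alaw tau4 (usvt t) It).
rewrite ge0_integralD//; last 4 first.
- by move=> t _; rewrite lee_fin.
- exact/measurable_EFinP.
- by move=> t _; rewrite -EFinD lee_fin addr_ge0.
- by apply/measurable_EFinP; exact: measurable_funD.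
rewrite ge0_integralD//; last 2 first.
- by move=> t _; rewrite lee_fin.
- exact/measurable_EFinP.
rewrite integral_cst// [X in (_ * X)%E](probability_setT P) mule1.
rewrite !EFinD; apply: leeD; last apply: leeD => //.
- under eq_integral => t _ do rewrite EFinM -sumEFin.
  rewrite ge0_integralZl//; last 2 first.
  + by apply: emeasurable_sum => f; apply/measurable_EFinP; exact: measurable_indic.
  + by move=> t _; apply: sume_ge0 => f _; rewrite lee_fin.
  rewrite [leRHS]EFinM lee_wpmul2l ?lee_fin ?sqr_ge0//.
  rewrite ge0_integral_sum//; last first.
    by move=> f; apply/measurable_EFinP; exact: measurable_indic.
  under eq_bigr => f _ do rewrite integral_indic// setIT.
  exact: large_noise_probability.
- under eq_integral => t _ do rewrite EFinM -sumEFin.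
  have mi i : measurable_fun setT (fun t => (\sum_j entry_error i j t)%:E).
    by apply/measurable_EFinP; apply: measurable_sum => j; exact: measurable_entry_error.
  have i0 i t : 0 <= \sum_j entry_error i j t.
    by apply: sumr_ge0 => j _; exact: entry_error_ge0.
  rewrite ge0_integralZl; last 4 first.
  + exact: measurableT.
  + exact: emeasurable_sum.
  + by move=> t _; apply: sume_ge0 => i _; rewrite lee_fin.
  + by rewrite lee_fin; exact: ler0n.
  rewrite [leRHS]EFinM; apply: lee_wpmul2l; first by rewrite lee_fin; exact: ler0n.
  rewrite ge0_integral_sum//; last by move=> i t _; rewrite lee_fin.
  apply: le_trans (expected_truncation_error iid tail0 htail hdiag).
  rewrite le_eqVlt; apply/orP; left; apply/eqP; apply: eq_bigr => i _.
  under eq_integral => t _ do rewrite -sumEFin.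
  rewrite ge0_integral_sum// => [j|j t _].
    by apply/measurable_EFinP; exact: measurable_entry_error.
  by rewrite lee_fin entry_error_ge0.
Qed.

End Risk.

Theorem theorem1 (R : realType) (alpha : R) (W : R -> R -> R) (ctau : R) :
  2^-1 < alpha -> graphon_class alpha W -> 4 <= ctau ->
  exists K : R,
  forall (n : nat) (d : measure_display) (T : measurableType d)
    (P : probability T R) (xi : 'I_n -> {RV P >-> R})
    (A : T -> 'M[bool]_n) (Mhat : T -> 'M[R]_n),
  (1 <= n)%N ->
  iid_uniform01 xi ->
  adjacency_given xi (fun t => prob_matrix W (fun i => xi i t)) A ->
  (forall t, is_usvt (ctau * Num.sqrt n%:R) (real_mx (A t)) (Mhat t)) ->
  ((n%:R ^- 2)%:E *
    'E_P[fun t => (frobenius_norm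
           (Mhat t - prob_matrix W (fun i => xi i t)) ^+ 2)%R] <=
   (K * n%:R `^ (- ((2 * alpha - 1) / (2 * alpha))))%:E)%E.
Proof.
move=> a2 [gW [omega [phi [[phi_L2 phi_orth _ _ _] [_ expan] [C C0 decay] diag]]]] c4.
have [r0 diag4] := diagonal_L2_bounded gW phi_L2 diag.
pose D := C ^+ 2 / (2 * alpha - 1).
have D0 : 0 <= D by rewrite divr_ge0 ?sqr_ge0//; lra.
exists (18 + 72 * ctau ^+ 2 * r0.+2%:R + 4097 * (D + 4)).
move=> n d T P xi A Mhat n0 iid Alaw usvt.
have [r [r0r rn rtail n_rho]] := truncation_rank r0 a2 n0.
set rho := n%:R `^ _ in rn rtail n_rho *.
have N0 : (0 : R) < n%:R by rewrite ltr0n.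
pose tail := D * r.+1%:R `^ (- (2 * alpha - 1)).
have tail0 : 0 <= tail by rewrite mulr_ge0 ?powR_ge0.
have htail := truncation_L2_error phi_L2 phi_orth expan (fun m => decay_tail r m a2 decay).
have tau4 : 4 * Num.sqrt n%:R <= ctau * Num.sqrt n%:R by rewrite ler_wpM2r ?sqrtr_ge0.
have risk := expected_risk gW phi_L2 n0 iid Alaw tau4 usvt tail0 htail (diag4 _ (leqW r0r)).
apply: le_trans (lee_wpmul2l _ risk) _; first by rewrite lee_fin invr_ge0 exprn_ge0 ?ltW.
have -> : (ctau * Num.sqrt n%:R) ^+ 2 = ctau ^+ 2 * n%:R by rewrite exprMn sqr_sqrtr.
rewrite -EFinM lee_fin.
have geo : (9 / 10 : R) ^+ n <= 9 / n%:R := geometric_le_inv n0.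
have -> : n%:R ^- 2 * (n%:R ^+ 2 * (2 * (9 / 10) ^+ n) +
    (72 * (ctau ^+ 2 * n%:R) * r.+1%:R + 4097 * (n%:R ^+ 2 * tail + 4 * n%:R))) =
    2 * (9 / 10) ^+ n + 72 * ctau ^+ 2 * (r.+1%:R / n%:R) + 4097 * (tail + 4 * n%:R^-1) :> R.
  set N := n%:R; by field; rewrite gt_eqF.
rewrite [leRHS]mulrDl [X in _ <= X + _]mulrDl; apply: lerD; first apply: lerD.
- apply: (@le_trans _ _ (18 * n%:R^-1)); last by rewrite ler_pM2l.
  by move: geo; set u := _ ^+ n; set v := _^-1; lra.
- rewrite -[leRHS]mulrA; apply: ler_wpM2l; last exact: rn.
  by apply: mulr_ge0; [exact: ler0n|exact: sqr_ge0].
- rewrite -[leRHS]mulrA; apply: ler_wpM2l; first exact: ler0n.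
  rewrite [leRHS]mulrDl; apply: lerD; last by rewrite ler_pM2l.
  by rewrite ler_wpM2l.
Qed.
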